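(* Let $K$ be an algebraically closed field and $q\ge 2$, and let $\mathcal{A}$ and $\mathcal{B}$ be D$_q$ subalgebras of $\mathrm{M}_n(K)$ of types $(n_1,n_2,\ldots,n_q)$ and $(\ell_1,\ell_2,\ldots,\ell_q)$, respectively, with max-dim db's $\mathcal{A}_{jj}$ and $\mathcal{B}_{jj}$, $j=1,\ldots,q$. Then $\mathcal{A}$ and $\mathcal{B}$ are isomorphic (as $K$-algebras) if and only if the $q$-tuples $(n_1,n_2,\ldots,n_q)$ and $(\ell_1,\ell_2,\ldots,\ell_q)$ are equal and the diagonal blocks $\mathcal{A}_{jj}$ and $\mathcal{B}_{jj}$ are conjugated for every $j=1,2,\ldots,q$. Moreover, in this case, for every $j=1,2,\ldots,q$ there is exactly one $k_j$ such that $\mathcal{A}_{jj}$ and $\mathcal{B}_{jj}$ are conjugated with $C^{k_j}_{n_j}(K)$.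
   Context: All algebras are associative and unital over the field $K$; a subalgebra of $\mathrm{M}_m(K)$ is a (unital) $K$-subalgebra. Subalgebras $\mathcal{S},\mathcal{T}$ of $\mathrm{M}_m(K)$ are conjugated if $\mathcal{T}=X^{-1}\mathcal{S}X$ for some invertible $X\in\mathrm{M}_m(K)$. $[x,y]=xy-yx$. An algebra is D$_q$ if it satisfies the identity $[x_1,y_1][x_2,y_2]\cdots[x_q,y_q]=0$. For positive integers $n_1,\ldots,n_q$ ($q\ge 2$) with $n_1+\cdots+n_q=n$, view matrices in $\mathrm{M}_n(K)$ as $q\times q$ block matrices whose $(i,j)$ block has size $n_i\times n_j$. A subalgebra $\mathcal{A}$ of $\mathrm{M}_n(K)$ is of type $(n_1,\ldots,n_q)$ if there are subalgebras $\mathcal{A}_{ii}$ of $\mathrm{M}_{n_i}(K)$, $i=1,\ldots,q$ (its diagonal blocks), such that $\mathcal{A}$ consists of exactly all block matrices whose $(i,i)$ block lies in $\mathcal{A}_{ii}$ (independently for each $i$), whose $(i,j)$ block is an arbitrary element of $\mathrm{M}_{n_i\times n_j}(K)$ for $i<j$, and whose $(i,j)$ block is zero for $i>j$. It is a D$_q$ subalgebra of $\mathrm{M}_n(K)$ of type $(n_1,\ldots,n_q)$ with max-dim db's if, moreover, every $\mathcal{A}_{ii}$ is a commutative subalgebra of $\mathrm{M}_{n_i}(K)$ with maximum dimension (equal to $\lfloor n_i^2/4\rfloor+1$). The algebras $C^k_m(K)\subseteq \mathrm{M}_m(K)$ are the following (with $e_{ij}$ the matrix units): - $C^1_1(K)=K$;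 - for $m=2\ell\ge 2$ even, $C^1_m(K)=KI_m+\begin{pmatrix}0_\ell & \mathrm{M}_\ell(K)\\ 0&0_\ell\end{pmatrix}$; - for $m=2\ell+1\ge3$ odd, $C^1_m(K)=KI_m+\begin{pmatrix}0_\ell & \mathrm{M}_{\ell\times(\ell+1)}(K)\\ 0&0_{\ell+1}\end{pmatrix}$ and $C^2_m(K)=KI_m+\begin{pmatrix}0_{\ell+1} & \mathrm{M}_{(\ell+1)\times\ell}(K)\\ 0&0_{\ell}\end{pmatrix}$; - $C^2_2(K)$ is the algebra of diagonal $2\times2$ matrices; - $C^3_3(K)=KI_3+K(e_{12}+e_{23})+Ke_{13}$; - $C^4_3(K)=\{a(e_{11}+e_{22})+be_{12}+ce_{33}: a,b,c\in K\}$; - $C^5_3(K)$ is the algebra of diagonal $3\times 3$ matrices. Thus the admissible superscripts $k$ for $C^k_m(K)$ are: $k=1$ if $m=1$ or $m\ge4$ is even; $k\in\{1,2\}$ if $m=2$ or $m\ge 5$ is odd; $k\in\{1,2,3,4,5\}$ if $m=3$. *)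

(* Defs.v *)
From HB Require Import structures.
From mathcomp Require Import all_boot all_order all_algebra.

Set Implicit Arguments.
Unset Strict Implicit.
Unset Printing Implicit Defensive.

Import GRing.Theory.
Local Open Scope ring_scope.

(* Subalgebras of M_m(K) are subspaces of 'M[K]_m rather than {aspace 'M[K]_m}
   because the latter requires m to be syntactically a successor. *)

Section MatrixSubalgebras.
Variable K : fieldType.

Definition subalgebra m (S : {vspace 'M[K]_m}) : Prop :=
  1%:M \in S /\ forall x y, x \in S -> y \in S -> x *m y \in S.

Definition commutative_subalgebra m (S : {vspace 'M[K]_m}) : Prop :=
  subalgebra S /\ forall x y, x \in S -> y \in S -> x *m y = y *m x.

(* The maximum is over all commutative subalgebras of M_m(K); that its value
   is floor(m^2/4) + 1 is a theorem and is not part of the definition. *)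
Definition max_dim_commutative m (S : {vspace 'M[K]_m}) : Prop :=
  commutative_subalgebra S /\
  forall T : {vspace 'M[K]_m}, commutative_subalgebra T -> (\dim T <= \dim S)%N.

(* T = X^-1 S X.  The two sizes are separate variables only so that blocks of
   sizes n_j and l_j can be compared without transporting along n_j = l_j; the
   relation itself forces them to be equal. *)
Definition conjugated m p (S : {vspace 'M[K]_m}) (T : {vspace 'M[K]_p}) : Prop :=
  exists (e : m = p) (X : 'M[K]_m), X \in unitmx /\
    forall Y : 'M[K]_p, Y \in T <->
      exists2 Z : 'M[K]_m, Z \in S & Y = castmx (e, e) (invmx X *m Z *m X).

(* 'M[K]_m is not an algType for a general m, hence no {lrmorphism _ -> _}:
   compatibility with 1 and with products is stated through vsval. *)
Definition alg_isomorphic m p (S : {vspace 'M[K]_m}) (T : {vspace 'M[K]_p})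
    : Prop :=
  exists f : {linear subvs_of S -> subvs_of T},
    [/\ bijective f,
        forall u, vsval u = 1%:M -> vsval (f u) = 1%:M
      & forall x y z, vsval z = vsval x *m vsval y ->
          vsval (f z) = vsval (f x) *m vsval (f y)].

Definition block q N (n : q.-tuple nat) (hn : (\sum_(i < q) tnth n i)%N = N)
    (x : 'M[K]_N) (i j : 'I_q) : 'M[K]_(tnth n i, tnth n j) :=
  submxblock (p_ := tnth n) (q_ := tnth n)
    (castmx (esym hn, esym hn) x) i j.

Definition of_type q N (n : q.-tuple nat)
    (hn : (\sum_(i < q) tnth n i)%N = N) (A : {vspace 'M[K]_N})
    (D : forall i : 'I_q, {vspace 'M[K]_(tnth n i)}) : Prop :=
  [/\ subalgebra A,
      forall i, subalgebra (D i)
    & forall x : 'M[K]_N, x \in A <->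
        (forall i, block hn x i i \in D i) /\
        (forall i j : 'I_q, (j < i)%N -> block hn x i j = 0)].

(* Such an A automatically satisfies [x_1,y_1]...[x_q,y_q] = 0: commutators of
   its elements are strictly block upper triangular. *)
Definition Dq_of_type_max_dim q N (n : q.-tuple nat)
    (hn : (\sum_(i < q) tnth n i)%N = N) (A : {vspace 'M[K]_N})
    (D : forall i : 'I_q, {vspace 'M[K]_(tnth n i)}) : Prop :=
  of_type hn A D /\ forall i, max_dim_commutative (D i).

(* Matrix unit e_{ij} with 1-based indices. *)
Definition E m (i j : nat) : 'M[K]_m :=
  \matrix_(r < m, c < m) ((r.+1 == i) && (c.+1 == j))%:R.

(* K I_m + (0_r, M_{r x (m-r)}(K); 0, 0_{m-r}) *)
Definition corner_algebra m (r : nat) : {vspace 'M[K]_m} :=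
  (<[1%:M]> + \sum_(i < m | (i < r)%N) \sum_(j < m | (r <= j)%N)
                <[delta_mx i j]>)%VS.

Definition diagonal_algebra m : {vspace 'M[K]_m} :=
  (\sum_(i < m) <[delta_mx i i]>)%VS.

(* C^k_m(K), meaningful only for k \in superscripts m. *)
Definition C k m : {vspace 'M[K]_m} :=
  match k with
  | 1 => corner_algebra m m./2
  | 2 => if (m == 2)%N then diagonal_algebra m else corner_algebra m (uphalf m)
  | 3 => (<[1%:M]> + <[E m 1 2 + E m 2 3]> + <[E m 1 3]>)%VS
  | 4 => (<[E m 1 1 + E m 2 2]> + <[E m 1 2]> + <[E m 3 3]>)%VS
  | 5 => diagonal_algebra m
  | _ => 0%VS
  end.

End MatrixSubalgebras.

Definition superscripts (m : nat) : seq nat :=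
  if (m == 3)%N then [:: 1; 2; 3; 4; 5]%N
  else if (m == 2)%N || ((5 <= m)%N && odd m) then [:: 1; 2]%N
  else [:: 1]%N.

(* Main.v *)
(* Classification of a commutative D of maximum dimension in M_m(K).  If D is
   local with maximal ideal J, let W be a complement of K^m J in K^m and
   r = dim W.  By Nakayama an element of J is determined by its restriction
   W -> K^m J, so dim D <= 1 + r (m - r).  In the extremal case every linear map
   W -> K^m J is realized by J; for r >= 2 commutativity then forces J^2 = 0,
   which gives C^1 and C^2, and r = 1 is only possible for m <= 3.  If D is not
   local, Fitting's lemma yields an idempotent, and the dimension bound leaves
   only m <= 3.

   Isomorphic block triangular algebras.  An isomorphism F : A -> B preserves
   the ideal T of strictly upper triangular elements, hence the ideals
   { a | T^(i-1) a T^(q-i) = 0 } = { a | a_ii = 0 }, and so it induces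
   isomorphisms A_ii -> B_ii; their dimensions determine n_i.  These are
   compatible with bijections of the off-diagonal blocks M_(n_i x n_j), and the
   dimension of the part of such a block annihilated by the square-zero
   elements of A_ii separates C^1 from C^2; the other C^k already differ as
   algebras. *)
From HB Require Import structures.
Require Import Defs.
From mathcomp Require Import all_boot all_order all_algebra zify.
From Stdlib Require Import Classical_Prop.

Set Implicit Arguments.
Unset Strict Implicit.
Unset Printing Implicit Defensive.

Import GRing.Theory.
Local Open Scope ring_scope.

(** For odd m = 2l+1 >= 3 the algebras C^1_m and C^2_m are isomorphic as algebras: both are the
    scalars plus a square-zero ideal of dimension l(l+1). So isomorphic diagonal blocks need not be
    conjugated, and the statement would fail for q = 1. For q >= 2 every diagonal block acts on some
    off-diagonal block, from the left or from the right, and this action recovers the lost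
    information. The obstacle to transporting the action is that F need not send the block
    idempotents e of A to the block idempotents e' of B: they agree only modulo strictly upper
    triangular terms, and F may spread a single block over several others. Cutting F down to one
    block still gives injective multiplicative maps, because F(e) e' F(e) = F(e). Uniqueness of k_j
    comes from the same invariant, since conjugated algebras also have linked actions. *)

(** * Conjugation of subalgebras *)

(* floor(m^2 / 4) *)
Definition quarter_square (m : nat) : nat := (m./2 * uphalf m)%N.

(** With d = |r - u|, (r + u)^2 = 4 r u + d^2; dividing by 4 and rounding down leaves the integer r
    u untouched. *)
Lemma quarter_square_excess r u : exists d, [/\ (quarter_square (r + u) = r * u + d./2 * uphalf d)%N & r = (u + d)%N \/ u = (r + d)%N].
Proof.
have H h d : quarter_square (h + (h + d)) = (h * (h + d) + d./2 * uphalf d)%N.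
  rewrite /quarter_square addnA addnn uphalf_half oddD odd_double halfD odd_double /= doubleK.
  by rewrite !uphalf_half; have := odd_double_half d; case: (odd d) => /=; nia.
have [le|/ltnW le] := leqP r u; [exists (u - r)%N | exists (r - u)%N]; split; try lia.
  by have := H r (u - r)%N; rewrite subnKC.
by have := H u (r - u)%N; rewrite subnKC // addnC mulnC.
Qed.

Lemma leq_quarter_square r u : (r * u <= quarter_square (r + u))%N.
Proof. by have [d [-> _]] := quarter_square_excess r u; apply: leq_addr. Qed.

(** The excess floor(d^2 / 4) vanishes only for [d <= 1]. The two ways of ordering the halves are
    the source of C^1 and C^2. *)
Lemma eq_quarter_square r u : (quarter_square (r + u) <= r * u)%N ->
  r = ((r + u)./2)%N \/ r = uphalf (r + u).
Proof.
have [d [-> dE]] := quarter_square_excess r u.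
rewrite -[leqRHS]addn0 leq_add2l leqn0 muln_eq0 => /orP H.
have d1 : (d <= 1)%N by case: H => /eqP; lia.
by lia.
Qed.

Section Conjugation.
Variables (K : fieldType) (m : nat).
Implicit Types (S T D : {vspace 'M[K]_m}) (X Y : 'M[K]_m).

(** [conjugated] for equal sizes, without the cast and as an equality of booleans that can be
    rewritten. *)
Definition simconj S T : Prop :=
  exists2 X, X \in unitmx & forall Y, (Y \in T) = (X *m Y *m invmx X \in S).

(** The algebra [D] written in the basis of row vectors formed by the rows of [X]. *)
Definition conj_vs X D : {vspace 'M[K]_m} :=
  (linfun (mulmxr (invmx X) \o mulmx X) @: D)%VS.

Lemma mem_conj_vs X D Y : X \in unitmx ->
  (Y \in conj_vs X D) = (invmx X *m Y *m X \in D).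
Proof.
move=> uX; apply/memv_imgP/idP => [[Z ZD ->]|YD].
  by rewrite lfunE /= !mulmxA mulVmx // mul1mx -mulmxA mulVmx // mulmx1.
exists (invmx X *m Y *m X) => //.
by rewrite lfunE /= !mulmxA mulmxV // mul1mx -mulmxA mulmxV // mulmx1.
Qed.

Lemma simconj_conj_vs X D : X \in unitmx -> simconj D (conj_vs X D).
Proof.
move=> uX; exists (invmx X); first by rewrite unitmx_inv.
by move=> Y; rewrite mem_conj_vs // invmxK.
Qed.

Lemma dim_simconj S T : simconj S T -> \dim T = \dim S.
Proof.
case=> X uX eT; have uX' : invmx X \in unitmx by rewrite unitmx_inv.
have -> : T = conj_vs (invmx X) S.
  by apply/vspaceP => Y; rewrite eT mem_conj_vs // invmxK.
apply: limg_dim_eq; apply/eqP; rewrite -subv0; apply/subvP => Y.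
rewrite memv_cap => /andP[_]; rewrite memv_ker lfunE /= invmxK => /eqP /(congr1 (mulmx X)).
rewrite mulmx0 !mulmxA mulmxV // mul1mx => /(congr1 (mulmxr (invmx X))) /=.
by rewrite mul0mx -mulmxA mulmxV // mulmx1 => ->; apply: mem0v.
Qed.

Lemma simconj_refl S : simconj S S.
Proof. by exists 1%:M => [|Y]; rewrite ?unitmx1 // mul1mx invmx1 mulmx1. Qed.

Lemma simconj_sym S T : simconj S T -> simconj T S.
Proof.
case=> X uX eT; exists (invmx X) => [|Y]; first by rewrite unitmx_inv.
by rewrite eT invmxK !mulmxA mulmxV // mul1mx -mulmxA mulmxV // mulmx1.
Qed.

Lemma simconj_trans S T D : simconj S T -> simconj T D -> simconj S D.
Proof.
move=> [X uX eT] [Y uY eD]; exists (X *m Y) => [|Z]; first by rewrite unitmx_mul uX.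
have -> : invmx (X *m Y) = invmx Y *m invmx X.
  apply: (can_inj (mulKmx (_ : X *m Y \in unitmx))); first by rewrite unitmx_mul uX.
  rewrite mulmxV ?unitmx_mul ?uX // -mulmxA (mulmxA Y) mulmxV // mul1mx.
  by rewrite mulmxV.
by rewrite eD eT !mulmxA.
Qed.

Lemma conjugatedP S T : conjugated S T <-> simconj S T.
Proof.
split=> [[e [X [uX eT]]]|[X uX eT]].
  exists X => // Y; apply/idP/idP => [/eT [Z ZS ->]|XY].
    rewrite castmx_id. rewrite !mulmxA mulmxV // mul1mx -mulmxA.
    by rewrite mulmxV // mulmx1.
  apply/eT; exists (X *m Y *m invmx X) => //.
  by rewrite castmx_id !mulmxA mulVmx // mul1mx -mulmxA mulVmx // mulmx1.
exists erefl, X; split=> // Y; rewrite eT; split=> [XY|[Z ZS ->]].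
  exists (X *m Y *m invmx X) => //.
  by rewrite castmx_id !mulmxA mulVmx // mul1mx -mulmxA mulVmx // mulmx1.
by rewrite castmx_id !mulmxA mulmxV // mul1mx -mulmxA mulmxV // mulmx1.
Qed.

Lemma simconj_commutative S T : simconj S T ->
  commutative_subalgebra S -> commutative_subalgebra T.
Proof.
case=> X uX eT [[S1 SM] SC].
have XM x y : X *m (x *m y) *m invmx X = (X *m x *m invmx X) *m (X *m y *m invmx X).
  by rewrite !mulmxA -(mulmxA _ (invmx X)) mulVmx // mulmx1.
split; [split|] => [|x y|x y]; rewrite !eT.
- by rewrite mulmx1 mulmxV.
- by rewrite XM; apply: SM.
move=> xS yS; have := SC _ _ xS yS; rewrite -!XM.
move/(can_inj (mulmxK (_ : invmx X \in unitmx))); rewrite unitmx_inv => /(_ uX).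
exact: (can_inj (mulKmx uX)).
Qed.

End Conjugation.

(** The left side exceeds [quarter_square a + quarter_square b] by a b / 2 rounded up, which is at
    most 1 only if a b <= 2. The slack 1 is the second scalar that a direct sum of two algebras
    contains. *)
Lemma quarter_square_split a b : (0 < a)%N -> (0 < b)%N ->
  (quarter_square (a + b) <= quarter_square a + quarter_square b + 1)%N -> (a + b <= 3)%N.
Proof.
rewrite /quarter_square => a0 b0.
have := odd_double_half a; have := odd_double_half b.
have := odd_double_half (a + b).
rewrite oddD !uphalf_half oddD.
case: (odd a); case: (odd b) => /=; nia.
Qed.

(** * Local commutative subalgebras *)

Lemma nilpotent_eigenvalue (K : fieldType) m p (a : 'M[K]_m) (Z : 'M[K]_(p, m)) c :
  (exists k, a ^+ k = 0) -> Z != 0 -> Z *m a = c *: Z -> c = 0.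
Proof.
case=> k ak Z0 Za.
have H n : Z *m a ^+ n = c ^+ n *: Z.
  elim: n => [|n IH]; first by rewrite !expr0 mulmx1 scale1r.
  by rewrite exprSr mulmxA IH -scalemxAl Za scalerA -exprSr.
move/eqP: (H k); rewrite ak mulmx0 eq_sym scaler_eq0 (negPf Z0) orbF expf_eq0.
by case/andP => _ /eqP.
Qed.

Section LocalAlgebras.
Variables (K : fieldType) (m : nat).
Implicit Types (D J : {vspace 'M[K]_m}) (a b Z P : 'M[K]_m).

(** Locality with residue field K, phrased without the maximal ideal, which [local_radical]
    constructs. *)
Definition local_subalgebra D : Prop :=
  forall a, a \in D -> exists c k, (a - c%:M) ^+ k = 0.

Lemma subalgebra_scalar D c : subalgebra D -> c%:M \in D.
Proof. by case=> D1 _; rewrite -scalemx1 memvZ. Qed.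

Lemma subalgebra_exp D a k : subalgebra D -> a \in D -> a ^+ k \in D.
Proof.
case=> D1 DM aD; elim: k => [|k IH]; first by rewrite expr0.
by rewrite exprS; apply: DM.
Qed.

(** For each [b] in a list, [Z P] is multiplied by the last power of the nilpotent part of [b] that
    does not kill it; the eigenvalue relations already obtained survive because [D] is commutative.
    The relations are linear in [b], so a basis of [D] is a sufficient list. *)
Lemma common_eigenmatrix D Z : commutative_subalgebra D -> local_subalgebra D ->
  Z != 0 -> exists P, [/\ P \in D, Z *m P != 0 &
    forall b, b \in D -> exists c, Z *m P *m b = c *: (Z *m P)].
Proof.
move=> [Da Dc] Dl Z0; have [D1 DM] := Da.
have Hs (s : seq 'M[K]_m) : {subset s <= D} -> exists P, [/\ P \in D, Z *m P != 0 &
    forall b, b \in s -> exists c, Z *m P *m b = c *: (Z *m P)].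
  elim: s => [|b s IH] sD; first by exists 1%:M; rewrite mulmx1.
  have [x xs|P [PD ZP Ps]] := IH; first by apply: sD; rewrite inE xs orbT.
  have bD : b \in D by apply: sD; rewrite inE eqxx.
  have [c [k bk]] := Dl b bD; set d := b - c%:M in bk.
  have dD : d \in D by apply: rpredB => //; apply: subalgebra_scalar.
  have : exists k, Z *m P *m d ^+ k == 0 by exists k; rewrite bk mulmx0.
  case/ex_minnP => -[|n]; first by rewrite expr0 mulmx1 (negPf ZP).
  move=> /eqP Zn min; have dn : d ^+ n \in D by apply: subalgebra_exp.
  have Zdn : Z *m P *m d ^+ n != 0 by apply/negP => /min; rewrite ltnn.
  exists (P *m d ^+ n); split; [exact: DM | by rewrite mulmxA |].
  move=> x; rewrite inE => /orP[/eqP->|xs].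
    exists c; apply/eqP; rewrite -subr_eq0 -mul_mx_scalar -mulmxBr -/d.
    by rewrite -!mulmxA -[d ^+ n *m d]exprSr mulmxA Zn.
  have [c' Px] := Ps _ xs; exists c'.
  rewrite !mulmxA -(mulmxA _ (d ^+ n)) (Dc _ _ dn); last by apply: sD; rewrite inE xs orbT.
  by rewrite !mulmxA Px -!scalemxAl.
have [x /vbasis_mem//|P [PD ZP Ps]] := Hs (vbasis D).
exists P; split=> // b bD; rewrite (coord_vbasis bD).
elim/big_ind: _ => [|x y [c Px] [d Py]|i _]; first by exists 0; rewrite mulmx0 scale0r.
  by exists (c + d); rewrite mulmxDr scalerDl Px Py.
have [|c Pi] := Ps (vbasis D)`_i; first by rewrite mem_nth ?size_tuple.
by exists (coord (vbasis D) i b * c); rewrite -scalemxAr Pi scalerA.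
Qed.

(** [D] acts by a character on a common eigenmatrix [P0] found in [D], and J is the kernel of that
    character, whence its codimension 1. The last clause is the form in which Nakayama's lemma is
    used: every nonzero [Z] has a nonzero multiple annihilated by J. *)
Lemma local_radical D : (0 < m)%N -> commutative_subalgebra D -> local_subalgebra D ->
  exists J, [/\ (J <= D)%VS, \dim D = (\dim J).+1,
    forall a, a \in D -> exists c, a - c%:M \in J,
    (forall a b, a \in J -> b \in D -> a *m b \in J) /\
    (forall a, a \in J -> exists k, a ^+ k = 0) &
    forall Z, Z != 0 -> exists P, [/\ P \in D, Z *m P != 0 &
      forall b, b \in J -> Z *m P *m b = 0]].
Proof.
move=> m0 Dcomm Dl; have [Da Dc] := Dcomm; have [D1 DM] := Da.
have I0 : 1%:M != 0 :> 'M[K]_m.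
  by case: (m) m0 => // n _; rewrite idmxE oner_eq0.
have [P0 []] := common_eigenmatrix Dcomm Dl I0; rewrite mul1mx => P0D P00 P0e.
pose J := (D :&: lker (linfun (mulmx P0)))%VS.
have JE a : (a \in J) = (a \in D) && (P0 *m a == 0).
  by rewrite memv_cap memv_ker lfunE.
have Jn a : a \in J -> exists k, a ^+ k = 0.
  rewrite JE => /andP[aD /eqP P0a]; have [c [k ak]] := Dl a aD.
  (* Since P0 a = 0, [P0] is an eigenmatrix of the nilpotent a - c for the eigenvalue -c. *)
  exists k; suff c0 : - c = 0 by move: ak; rewrite -[c]opprK c0 oppr0 raddf0 subr0.
  apply: (nilpotent_eigenvalue (ex_intro _ k ak) P00).
  by rewrite mulmxBr P0a sub0r mul_mx_scalar scaleNr.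
have Dcos a : a \in D -> exists c, a - c%:M \in J.
  move=> aD; have [c ac] := P0e a aD; exists c.
  rewrite JE rpredB ?subalgebra_scalar //= mulmxBr ac mul_mx_scalar subrr eqxx //.
exists J; split=> //.
- exact: capvSl.
- have -> : D = (<[1%:M]> + J)%VS.
    apply/eqP; rewrite eqEsubv; apply/andP; split; apply/subvP => a.
      move=> /Dcos [c ac]; apply/memv_addP; exists c%:M.
        by apply/vlineP; exists c; rewrite scalemx1.
      by exists (a - c%:M) => //; rewrite addrC subrK.
    case/memv_addP => x /vlineP [c ->] [y]; rewrite JE => /andP[yD _] ->.
    by rewrite rpredD ?memvZ.
  rewrite dimv_disjoint_sum ?dim_vline ?I0 //; apply/eqP; rewrite -subv0.
  apply/subvP => x; rewrite memv_cap => /andP[/vlineP [c ->]]; rewrite JE.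
  rewrite -scalemxAr mulmx1 scaler_eq0 (negPf P00) orbF => /andP[_ /eqP->].
  by rewrite scale0r mem0v.
- split=> // a b; rewrite !JE => /andP[aD /eqP P0a] bD.
  by rewrite DM // mulmxA P0a mul0mx eqxx.
move=> Z /(common_eigenmatrix Dcomm Dl) [P [PD ZP Pe]]; exists P; split=> // b bJ.
have [|c bc] := Pe b; first by move: bJ; rewrite JE => /andP[].
by rewrite bc (nilpotent_eigenvalue (Jn b bJ) ZP bc) scale0r.
Qed.

(* [B1] spans the row space of the maximal ideal J and [B0] a complement, that
   is, a minimal set of generators of K^m as a J-module.  An element of J that
   kills the generators is 0 by Nakayama's lemma. *)
Lemma local_generators D : (0 < m)%N -> commutative_subalgebra D -> local_subalgebra D ->
  exists r u (B0 : 'M[K]_(r, m)) (B1 : 'M[K]_(u, m)) J,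
  [/\ (r + u = m)%N, (0 < r)%N, row_full (col_mx B0 B1),
   (J <= D)%VS /\ (forall a, a \in J -> exists k, a ^+ k = 0) &
   [/\ \dim D = (\dim J).+1,
    forall a, a \in D -> exists c, a - c%:M \in J,
    forall a b, a \in J -> b \in D -> a *m b \in J,
    forall a, a \in J -> (a <= B1)%MS &
    forall a, a \in J -> B0 *m a = 0 -> a = 0]].
Proof.
move=> m0 Dcomm Dl; have [Da Dc] := Dcomm.
have [J [JD dJ DJ [JM Jn] soc]] := local_radical m0 Dcomm Dl.
pose U := (\sum_(i < \dim J) <<(vbasis J)`_i>>)%MS.
have JU a : a \in J -> (a <= U)%MS.
  move=> aJ; rewrite (coord_vbasis aJ); apply: summx_sub => i _.
  by apply: scalemx_sub; apply: (sumsmx_sup i) => //; rewrite genmxE.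
pose B0 := row_base (U^C)%MS; pose B1 := row_base U.
have full : row_full (col_mx B0 B1).
  rewrite -sub1mx (submx_trans (submx_full _ (addsmx_compl_full U))) //.
  rewrite addsmxC -addsmxE; apply: addsmxS; by rewrite eq_row_base.
(* If [a] were nonzero, some nonzero [a P] would be annihilated by J. It kills [B0] because [a]
   does, and [B1] because it commutes with J, whose rows span [B1]; so it would kill everything. *)
have inj a : a \in J -> B0 *m a = 0 -> a = 0.
  move=> aJ B0a; apply/eqP/negPn/negP => /soc [P [PD aP0 aPJ]].
  case/negP: aP0; have [Y YB] := row_fullP full.
  rewrite -[a]mul1mx -YB -!mulmxA.
  suff -> : col_mx B0 B1 *m (a *m P) = 0 by rewrite mulmx0.
  rewrite mul_col_mx mulmxA B0a mul0mx.
  suff : (B1 <= kermx (a *m P))%MS by move/sub_kermxP ->; rewrite col_mx0.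
  rewrite eq_row_base; apply/sumsmx_subP => i _; rewrite genmxE.
  have iJ : (vbasis J)`_i \in J by apply: vbasis_mem; rewrite mem_nth ?size_tuple.
  apply/sub_kermxP; rewrite (Dc _ _ _ _) ?aPJ //; first exact: (subvP JD).
  by apply: Da.2 => //; apply: (subvP JD).
exists (\rank U^C)%MS, (\rank U), B0, B1, J; split=> //.
- by rewrite mxrank_compl subnK // rank_leq_row.
(* Without generators [inj] would give J = 0, hence U = 0 and a complement of full dimension m. *)
- rewrite lt0n; apply/negP => /eqP r0.
  have B00 : B0 = 0.
    by apply/eqP; rewrite -mxrank_eq0 eq_row_base r0.
  have U0 : U = 0.
    rewrite /U big1 // => i _.
    have iJ : (vbasis J)`_i \in J by apply: vbasis_mem; rewrite mem_nth ?size_tuple.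
    by rewrite (inj _ iJ) ?genmx0 // B00 mul0mx.
  by move: r0; rewrite mxrank_compl U0 mxrank0 subn0; lia.
by split=> // a /JU; rewrite eq_row_base.
Qed.

Lemma dim_local D : (0 < m)%N -> commutative_subalgebra D -> local_subalgebra D ->
  (\dim D <= (quarter_square m).+1)%N.
Proof.
move=> m0 Dcomm Dl.
have [r [u [B0 [B1 [J [rum _ _ _ [-> _ _ JB inj]]]]]]] := local_generators m0 Dcomm Dl.
have := leq_quarter_square r u; rewrite rum ltnS; apply: leq_trans.
(* For [a] in J, [f a] is the r x u matrix of coordinates of the images of the generators: B0 a = (f
   a) B1. *)
pose f := linfun (mulmxr (pinvmx B1) \o mulmx B0).
suff fJ : (J :&: lker f = 0)%VS.
  by rewrite -(limg_dim_eq fJ) (leq_trans (dimvS (subvf _))) // dimvf dim_matrix.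
apply/eqP; rewrite -subv0; apply/subvP => a; rewrite memv_cap memv_ker lfunE /=.
case/andP => aJ /eqP /(congr1 (mulmxr B1)) /=.
rewrite mulmxKpV ?mul0mx; last by apply: submx_trans (JB _ aJ); apply: submxMl.
by move/(inj _ aJ) ->; apply: mem0v.
Qed.

End LocalAlgebras.

(** * Splitting along an idempotent *)

Section Idempotents.
Variable K : fieldType.

(** The descending ideals b^k D stabilise, so b^k = b^(k+1) y with y in [D], and b^(k+1) y^(k+1) is
    an idempotent of [D]. It is nonzero because [b] is not nilpotent, and it is not 1 because w b =
    0. *)
Lemma fitting_idempotent m (D : {vspace 'M[K]_m}) b (w : 'rV[K]_m) :
  commutative_subalgebra D -> b \in D -> (forall k, b ^+ k != 0) ->
  w != 0 -> w *m b = 0 ->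
  exists e, [/\ e \in D, e *m e = e, e != 0 & e != 1%:M].
Proof.
move=> [Da Dc] bD bn w0 wb; have [D1 DM] := Da.
pose I k := (linfun (mulmx (b ^+ k)) @: D)%VS.
have bX k : b ^+ k \in D by apply: subalgebra_exp.
have IS k : (I k.+1 <= I k)%VS.
  apply/subvP => x /memv_imgP [y yD ->]; rewrite lfunE /= exprSr.
  by rewrite -[_ *m y]mulmxA -[_ *m (b *m y)]lfunE /= memv_img // DM.
have [k Ik] : exists k, (\dim (I k) <= \dim (I k.+1))%N.
  have H n : forall k, (\dim (I k) <= n)%N -> exists k, (\dim (I k) <= \dim (I k.+1))%N.
    elim: n => [|n IH] k kn; first by exists k; apply: leq_trans kn _.
    have [le|lt] := leqP (\dim (I k)) (\dim (I k.+1)); first by exists k.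
    by apply: (IH k.+1); rewrite -ltnS (leq_trans lt).
  exact: (H _ 0%N (leqnn _)).
have /memv_imgP [y yD] : b ^+ k \in I k.+1.
  have /eqP-> : (I k.+1 == I k) by rewrite eqEdim IS.
  by rewrite -[X in X \in _](mulmx1 (b ^+ k)) -[_ *m _]lfunE /= memv_img.
rewrite lfunE /= => bk; have cby : GRing.comm b y by apply: Dc.
have H j : b ^+ k = b ^+ (k + j) * y ^+ j.
  elim: j => [|j IH]; first by rewrite addn0 expr0 mulr1.
  rewrite {1}IH addnC exprD {1}bk mulmxE.
  by rewrite -addSnnS addnC exprD [y ^+ j.+1]exprS !mulrA.
have cyb i j : GRing.comm (y ^+ i) (b ^+ j) by apply/commrX/commr_sym/commrX.
pose e := b ^+ k.+1 * y ^+ k.+1.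
have bb : b ^+ k.+1 * e = b ^+ k.+1.
  rewrite /e {1}exprS -!mulrA [b ^+ k * _]mulrA -exprD -H -exprS //.
have ee : e * e = e.
  have -> : e * e = b ^+ k.+1 * e * y ^+ k.+1.
    rewrite /e -!mulrA; congr (_ * _); rewrite !mulrA; congr (_ * _).
    exact: cyb.
  by rewrite bb.
exists e; split=> //.
- by apply: DM; [apply: bX | apply: subalgebra_exp].
- by apply/negP => /eqP e0; case/negP: (bn k.+1); rewrite -bb e0 mulr0.
apply/negP => /eqP e1; case/negP: w0; rewrite -[w]mulmx1 -e1 /e.
by rewrite exprS -mulmxE !mulmxA wb !mul0mx.
Qed.

Lemma idempotent_basis m (e : 'M[K]_m) : e *m e = e ->
  exists r u (B0 : 'M[K]_(r, m)) (B1 : 'M[K]_(u, m)),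
  [/\ (r + u = m)%N, row_full (col_mx B0 B1), B0 *m e = B0, B1 *m e = 0 &
      r = \rank e /\ u = \rank (1%:M - e)].
Proof.
move=> ee; pose f := 1%:M - e; have fe : f *m e = 0 by rewrite mulmxBl mul1mx ee subrr.
have ef : e *m f = 0 by rewrite mulmxBr mulmx1 ee subrr.
exists (\rank e), (\rank f), (row_base e), (row_base f).
have full : row_full (col_mx (row_base e) (row_base f)).
  rewrite -sub1mx -addsmxE; have -> : 1%:M = e + f by rewrite addrC subrK.
  by apply: addmx_sub_adds; rewrite eq_row_base.
have eE : row_base e *m e = row_base e.
  have /submxP [Y ->] : (row_base e <= e)%MS by rewrite eq_row_base.
  by rewrite -mulmxA ee.
have fE : row_base f *m e = 0.
  have /submxP [Y ->] : (row_base f <= f)%MS by rewrite eq_row_base.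
  by rewrite -mulmxA fe mulmx0.
split=> //; suff -> : \rank f = \rank (kermx e) by rewrite mxrank_ker subnKC ?rank_leq_row.
apply/eqP; rewrite eqn_leq !mxrankS //; last exact/sub_kermxP.
have -> : kermx e = kermx e *m f by rewrite mulmxBr mulmx1 mulmx_ker subr0.
exact: submxMl.
Qed.

End Idempotents.

Section DirectSum.
Variables (K : fieldType) (m1 m2 : nat).
Implicit Types (D : {vspace 'M[K]_m1}) (F : {vspace 'M[K]_m2}).

Definition ul_block (a : 'M[K]_m1) : 'M[K]_(m1 + m2) := block_mx a 0 0 0.
Definition dr_block (b : 'M[K]_m2) : 'M[K]_(m1 + m2) := block_mx 0 0 0 b.

Lemma ul_block_is_linear :
  linear ul_block.
Proof.
by move=> c x y; rewrite /ul_block /dr_block scale_block_mx add_block_mx !scaler0 !addr0.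
Qed.
HB.instance Definition _ := GRing.isLinear.Build K 'M[K]_m1 'M[K]_(m1 + m2) _ ul_block
  ul_block_is_linear.

Lemma dr_block_is_linear :
  linear dr_block.
Proof.
by move=> c x y; rewrite /ul_block /dr_block scale_block_mx add_block_mx !scaler0 !addr0.
Qed.
HB.instance Definition _ := GRing.isLinear.Build K 'M[K]_m2 'M[K]_(m1 + m2) _ dr_block
  dr_block_is_linear.

Definition dsum D F : {vspace 'M[K]_(m1 + m2)} :=
  (linfun ul_block @: D + linfun dr_block @: F)%VS.

Lemma mem_dsum D F x : reflect
  (exists a b, [/\ a \in D, b \in F & x = block_mx a 0 0 b]) (x \in dsum D F).
Proof.
apply: (iffP memv_addP) => [[y /memv_imgP [a aD ->] [z /memv_imgP [b bD ->] ->]]|].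
  by exists a, b; split=> //; rewrite !lfunE /= add_block_mx !addr0 !add0r.
case=> a [b [aD bD ->]]; exists (ul_block a).
  by rewrite -[ul_block a]lfunE memv_img.
exists (dr_block b); first by rewrite -[dr_block b]lfunE memv_img.
by rewrite add_block_mx !addr0 !add0r.
Qed.

Lemma dim_dsum_leq D F : (\dim (dsum D F) <= \dim D + \dim F)%N.
Proof.
rewrite (leq_trans (dimv_add_leqif _ _)) // leq_add //.
  by rewrite -(limg_ker_dim (linfun ul_block) D) leq_addl.
by rewrite -(limg_ker_dim (linfun dr_block) F) leq_addl.
Qed.

(** In a basis adapted to [e] the idempotent becomes [p]. Commuting with [p] makes every element
    block diagonal, and multiplying by [p] shows that its two blocks lie in the algebra separately,
    so the algebra is a full direct sum. *)
Lemma idempotent_split (A : {vspace 'M[K]_(m1 + m2)}) e :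
  commutative_subalgebra A -> e \in A -> e *m e = e ->
  \rank e = m1 -> \rank (1%:M - e) = m2 ->
  exists D F, [/\ commutative_subalgebra D, commutative_subalgebra F &
                   simconj A (dsum D F)].
Proof.
move=> Acomm eA ee re rf.
have [r [u [B0 [B1 [_ full B0e B1e [rE uE]]]]]] := idempotent_basis ee.
rewrite re in rE; rewrite rf in uE; subst r u.
have uX : col_mx B0 B1 \in unitmx by rewrite -row_full_unit.
set X := col_mx B0 B1 in full uX; pose A' := conj_vs X A.
have AA' : simconj A A' by apply: simconj_conj_vs.
have [[A1 AM] AC] := simconj_commutative AA' Acomm.
pose p : 'M[K]_(m1 + m2) := block_mx 1%:M 0 0 0.
have pA : p \in A'.
  rewrite mem_conj_vs // -mulmxA; suff -> : p *m X = X *m e by rewrite mulKmx.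
  by rewrite [RHS]mul_col_mx B0e B1e mul_block_col !mul0mx mul1mx !addr0.
have blk x : x \in A' -> [/\ block_mx (ulsubmx x) 0 0 0 \in A',
     block_mx 0 0 0 (drsubmx x) \in A' & x = block_mx (ulsubmx x) 0 0 (drsubmx x)].
  move=> xA; have xE : x = block_mx (ulsubmx x) 0 0 (drsubmx x).
    have := AC _ _ xA pA; rewrite -{1 2 3}[x]submxK !mulmx_block.
    rewrite !mulmx0 !mul0mx !mulmx1 !mul1mx !addr0.
    by move=> /eq_block_mx [_ <- -> _].
  have ulA : block_mx (ulsubmx x) 0 0 0 \in A'.
    have := AM _ _ pA xA; rewrite {1}xE mulmx_block.
    by rewrite !mulmx0 !mul0mx !mul1mx !addr0.
  split=> //; have := rpredB xA ulA; rewrite {1}xE opp_block_mx add_block_mx.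
  by rewrite !oppr0 !addr0 subrr.
pose D := (linfun (lsubmx \o usubmx) @: A')%VS; pose F := (linfun (rsubmx \o dsubmx) @: A')%VS.
have DP x : reflect (block_mx x 0 0 0 \in A') (x \in D).
  apply: (iffP memv_imgP) => [[y /blk [yA _ _] ->]|xA]; first by rewrite lfunE.
  by exists (block_mx x 0 0 0); rewrite // lfunE; apply: esym; apply: block_mxKul.
have FP x : reflect (block_mx 0 0 0 x \in A') (x \in F).
  apply: (iffP memv_imgP) => [[y /blk [_ yA _] ->]|xA]; first by rewrite lfunE.
  by exists (block_mx 0 0 0 x); rewrite // lfunE; apply: esym; apply: block_mxKdr.
have [D1 F1 _] := blk _ A1; move: D1 F1; rewrite scalar_mx_block block_mxKul block_mxKdr => D1 F1.
exists D, F; split.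
- split; [split|] => [|x y /DP xD /DP yD|x y /DP xD /DP yD]; first exact/DP.
    apply/DP; have := AM _ _ xD yD; rewrite mulmx_block.
    by rewrite !mulmx0 !mul0mx !addr0.
  have := AC _ _ xD yD; rewrite !mulmx_block.
  by rewrite !mulmx0 !mul0mx !addr0 => /eq_block_mx [].
- split; [split|] => [|x y /FP xD /FP yD|x y /FP xD /FP yD]; first exact/FP.
    apply/FP; have := AM _ _ xD yD; rewrite mulmx_block.
    by rewrite !mulmx0 !mul0mx !addr0 !add0r.
  have := AC _ _ xD yD; rewrite !mulmx_block.
  by rewrite !mulmx0 !mul0mx !addr0 !add0r => /eq_block_mx [].
suff <- : A' = dsum D F by [].
apply/vspaceP => x; apply/idP/mem_dsum => [/blk [xD xF xE]|[a [b [/DP aA /FP bA ->]]]].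
  by exists (ulsubmx x), (drsubmx x); split=> //; [apply/DP|apply/FP].
by have := rpredD aA bA; rewrite add_block_mx !addr0 !add0r.
Qed.

Lemma simconj_dsum (D D' : {vspace 'M[K]_m1}) (F F' : {vspace 'M[K]_m2}) :
  simconj D D' -> simconj F F' -> simconj (dsum D F) (dsum D' F').
Proof.
case=> X uX eD [Y uY eF]; pose Z := block_mx X 0 0 Y.
pose Z' := block_mx (invmx X) 0 0 (invmx Y).
have ZZ' : Z *m Z' = 1%:M.
  by rewrite mulmx_block !mulmx0 !mul0mx !addr0 !add0r !mulmxV // -scalar_mx_block.
have [uZ _] := mulmx1_unit ZZ'.
have iZ : invmx Z = Z' by rewrite -[invmx Z]mulmx1 -ZZ' mulKmx.
exists Z => // x; apply/mem_dsum/mem_dsum => [[a [b [aD bF ->]]]|[a [b [aD bF]]]].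
  exists (X *m a *m invmx X), (Y *m b *m invmx Y); rewrite -eD -eF; split=> //.
  by rewrite iZ !mulmx_block !(mulmx0, mul0mx, addr0, add0r).
move=> xE; exists (invmx X *m a *m X), (invmx Y *m b *m Y).
rewrite eD eF !mulmxA !mulmxV // !mul1mx -!mulmxA !mulmxV // !mulmx1; split=> //.
have <- : invmx Z *m (Z *m x *m invmx Z) *m Z = x by rewrite !mulmxA mulVmx // mul1mx mulmxKV.
by rewrite xE iZ !mulmx_block !(mulmx0, mul0mx, addr0, add0r) !mulmxA.
Qed.

End DirectSum.

(** * The dimension bound over an algebraically closed field *)

Section Bound.
Variable K : closedFieldType.

Lemma exists_eigenvector m (a : 'M[K]_m) : (0 < m)%N ->
  exists c (w : 'rV_m), w != 0 /\ w *m (a - c%:M) = 0.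
Proof.
move=> m0; have /closed_rootP [c] : size (char_poly a) != 1%N.
  by rewrite size_char_poly; lia.
rewrite -eigenvalue_root_char => /eigenvalueP [w wa w0]; exists c, w; split=> //.
by rewrite mulmxBr wa mul_mx_scalar subrr.
Qed.

(** If [a] is not a scalar plus a nilpotent and c is an eigenvalue of [a], then a - c is singular
    but not nilpotent, which is what Fitting's lemma asks for. *)
Lemma local_or_idempotent m (D : {vspace 'M[K]_m}) : (0 < m)%N ->
  commutative_subalgebra D -> local_subalgebra D \/
  exists e, [/\ e \in D, e *m e = e, e != 0 & e != 1%:M].
Proof.
move=> m0 Dcomm; have [|nl] := classic (local_subalgebra D); [by left | right].
have [Da Dc] := Dcomm.
apply: NNPP => noid; apply: nl => a aD; apply: NNPP => na; apply: noid.
have [c [w [w0 wac]]] := exists_eigenvector a m0.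
apply: (fitting_idempotent Dcomm (rpredB aD (subalgebra_scalar c Da)) _ w0 wac) => k.
by apply/negP => /eqP ak; apply: na; exists c, k.
Qed.

Lemma dim_commutative m (D : {vspace 'M[K]_m}) : (0 < m)%N ->
  commutative_subalgebra D -> (\dim D <= (quarter_square m).+1)%N.
Proof.
elim/ltn_ind: m D => m IH D m0 Dcomm.
have [Dl|[e [eD ee e0 e1]]] := local_or_idempotent m0 Dcomm; first exact: dim_local.
have [r [u [_ [_ [rum _ _ _ [rE uE]]]]]] := idempotent_basis ee.
have r0 : (0 < r)%N by rewrite rE lt0n mxrank_eq0.
have u0 : (0 < u)%N by rewrite uE lt0n mxrank_eq0 subr_eq0 eq_sym.
subst m; have [D1 [D2 [D1c D2c DD]]] := idempotent_split Dcomm eD ee (esym rE) (esym uE).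
rewrite -(dim_simconj DD) (leq_trans (dim_dsum_leq _ _)) //.
have dD1 : (\dim D1 <= (quarter_square r).+1)%N by apply: IH => //; lia.
have dD2 : (\dim D2 <= (quarter_square u).+1)%N by apply: IH => //; lia.
apply: leq_trans (leq_add dD1 dD2) _; rewrite addSn addnS !ltnS.
rewrite ltnNge; apply/negP => le.
(* A direct sum exceeding the bound would have to be this small, and for sizes 2 and 3 the bound is
   checked directly. *)
have le3 : (r + u <= 3)%N by apply: quarter_square_split => //; lia.
have : ((r, u) \in [:: (1, 1); (1, 2); (2, 1)])%N by rewrite !inE /= !xpair_eqE; lia.
by rewrite !inE => /or3P[] /eqP [rE' uE']; move: le; rewrite rE' uE'.
Qed.
End Bound.

(** * The algebras C^k_m *)

Section Corner.
Variables (K : fieldType) (r u : nat).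

Definition ur_block (a : 'M[K]_(r, u)) : 'M[K]_(r + u) := block_mx 0 a 0 0.

Lemma ur_block_is_linear : linear ur_block.
Proof.
by move=> c x y; rewrite /ur_block scale_block_mx add_block_mx !scaler0 !addr0.
Qed.
HB.instance Definition _ := GRing.isLinear.Build K 'M[K]_(r, u) 'M[K]_(r + u) _ ur_block
  ur_block_is_linear.

Lemma corner_block :
  corner_algebra K (r + u) r = (<[1%:M]> + linfun ur_block @: fullv)%VS.
Proof.
rewrite /corner_algebra; congr (_ + _)%VS; apply/eqP; rewrite eqEsubv; apply/andP; split.
  apply/subv_sumP => i ir; apply/subv_sumP => j rj; rewrite -memvE.
  case: (split_ordP i) ir => i' -> /= ir; last by exfalso; lia.
  case: (split_ordP j) rj => j' -> /= rj; first by have := ltn_ord j'; lia.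
  apply/memv_imgP; exists (delta_mx i' j'); first exact: memvf.
  rewrite lfunE; apply/matrixP => s t; rewrite mxE.
  case: (split_ordP s) => s' ->; case: (split_ordP t) => t' ->.
  - by rewrite block_mxEul mxE eq_lrshift andbF.
  - by rewrite block_mxEur mxE eq_lshift eq_rshift.
  - by rewrite block_mxEdl mxE eq_rlshift.
  by rewrite block_mxEdr mxE eq_rlshift.
apply/subvP => x /memv_imgP [a _ ->]; rewrite lfunE [X in X \in _]matrix_sum_delta.
apply: rpred_sum => s _; apply: rpred_sum => t _.
case: (split_ordP s) => s' ->; case: (split_ordP t) => t' ->.
- by rewrite block_mxEul mxE scale0r mem0v.
- apply: memvZ; rewrite memvE; apply: (sumv_sup (lshift u s')); first by rewrite /= ltn_ord.
  by apply: (sumv_sup (rshift r t')); rewrite //= leq_addr.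
- by rewrite block_mxEdl mxE scale0r mem0v.
by rewrite block_mxEdr mxE scale0r mem0v.
Qed.

Lemma mem_corner_block x : reflect (exists c a, x = c%:M + ur_block a)
  (x \in corner_algebra K (r + u) r).
Proof.
rewrite corner_block; apply: (iffP memv_addP) => [[y /vlineP [c ->] [z]]|[c [a ->]]].
  by move=> /memv_imgP [a _ ->] ->; exists c, a; rewrite lfunE scalemx1.
exists c%:M; first by apply/vlineP; exists c; rewrite scalemx1.
by exists (ur_block a); rewrite // -[ur_block a]lfunE memv_img ?memvf.
Qed.

Lemma ur_block_mul a b : ur_block a *m ur_block b = 0.
Proof. by rewrite mulmx_block !(mulmx0, mul0mx, addr0) -block_mx0. Qed.

Lemma corner_commutative : commutative_subalgebra (corner_algebra K (r + u) r).
Proof.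
have M c a d b : (c%:M + ur_block a) *m (d%:M + ur_block b) =
    (c * d)%:M + ur_block (c *: b + d *: a).
  rewrite mulmxDl !mulmxDr ur_block_mul addr0 -scalar_mxM mul_scalar_mx mul_mx_scalar.
  by rewrite linearD !linearZ addrA.
split; [split|].
- by apply/mem_corner_block; exists 1, 0; rewrite linear0 addr0.
- move=> _ _ /mem_corner_block[c [a ->]] /mem_corner_block[d [b ->]]; rewrite M.
  by apply/mem_corner_block; exists (c * d), (c *: b + d *: a).
move=> _ _ /mem_corner_block[c [a ->]] /mem_corner_block[d [b ->]].
by rewrite !M mulrC [c *: b + _]addrC.
Qed.

Lemma dim_corner : (0 < r + u)%N -> \dim (corner_algebra K (r + u) r) = (r * u).+1.
Proof.
move=> ru0; have I0 : 1%:M != 0 :> 'M[K]_(r + u).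
  by case: (r + u)%N ru0 => // n _; rewrite idmxE oner_eq0.
rewrite corner_block dimv_disjoint_sum.
  rewrite dim_vline I0 limg_dim_eq ?dimvf ?dim_matrix //.
  apply/eqP; rewrite -subv0 capfv; apply/subvP => a; rewrite memv_ker lfunE.
  by rewrite -block_mx0 => /eqP /eq_block_mx [_ -> _ _]; apply: mem0v.
apply/eqP; rewrite -subv0; apply/subvP => x; rewrite memv_cap.
case/andP => /vlineP [c ->] /memv_imgP [a _]; rewrite lfunE scalemx1 => cE.
have : c%:M *m c%:M = 0 :> 'M[K]_(r + u) by rewrite cE ur_block_mul.
rewrite -scalar_mxM -scalemx1 => /eqP; rewrite scaler_eq0 (negPf I0) orbF mulf_eq0 orbb.
by move/eqP->; rewrite raddf0 mem0v.
Qed.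

End Corner.

(** Maximality is tested against the corner algebra whose two blocks are the halves of [m]. *)
Lemma dim_max_commutative (K : closedFieldType) m (D : {vspace 'M[K]_m}) :
  (0 < m)%N -> max_dim_commutative D -> \dim D = (quarter_square m).+1.
Proof.
move=> m0 [Dc Dm]; apply/eqP; rewrite eqn_leq dim_commutative //=.
have : (m./2 + uphalf m = m)%N by lia.
rewrite /quarter_square; move: (m./2) (uphalf m) => r u ru; subst m.
by rewrite -(dim_corner K m0); apply/Dm/corner_commutative.
Qed.

Section SmallAlgebras.
Variable K : fieldType.

Lemma dim_vline_leq1 (vT : vectType K) (v : vT) : (\dim <[v]> <= 1)%N.
Proof. by rewrite dim_vline; case: (v != 0). Qed.

Lemma mem_diagonal m (x : 'M[K]_m) :
  reflect (forall i j, i != j -> x i j = 0) (x \in diagonal_algebra K m).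
Proof.
apply: (iffP memv_sumP) => [[y yP ->] i j ij|xd].
  rewrite summxE big1 // => k _; have /vlineP [c ->] := yP k isT.
  rewrite !mxE; case: (i =P k) => [ik|_]; last by rewrite mulr0.
  by rewrite -ik [j == i]eq_sym (negPf ij) mulr0.
exists (fun i => x i i *: delta_mx i i) => [i _|]; first exact/memvZ/memv_line.
rewrite {1}[x]matrix_sum_delta; apply: eq_bigr => i _.
by rewrite (bigD1 i) //= big1 ?addr0 // => j ji; rewrite xd ?scale0r // eq_sym.
Qed.

Lemma dim_diagonal m : (\dim (diagonal_algebra K m) <= m)%N.
Proof.
apply: leq_trans (dimv_leq_sum _ _ _) _.
apply: leq_trans (leq_sum _ (fun i _ => dim_vline_leq1 (delta_mx i i))) _.
by rewrite sum_nat_const card_ord muln1.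
Qed.

Lemma dim_vline3 (vT : vectType K) (a b c : vT) : (\dim (<[a]> + <[b]> + <[c]>) <= 3)%N.
Proof.
apply: leq_trans (dimv_add_leqif _ _) _; rewrite -[3%N]/(2 + 1)%N leq_add ?dim_vline_leq1 //.
by apply: leq_trans (dimv_add_leqif _ _) _; rewrite -[2%N]/(1 + 1)%N leq_add ?dim_vline_leq1.
Qed.

Lemma memv_vline3 (vT : vectType K) (a b c x : vT) :
  reflect (exists i j k, x = i *: a + j *: b + k *: c) (x \in <[a]> + <[b]> + <[c]>)%VS.
Proof.
apply: (iffP memv_addP) => [[y /memv_addP [z /vlineP [i ->] [t /vlineP [j ->] ->]]]|].
  by case=> w /vlineP [k ->] ->; exists i, j, k.
case=> i [j [k ->]]; exists (i *: a + j *: b); first by rewrite memv_add ?memvZ ?memv_line.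
by exists (k *: c); rewrite // memvZ ?memv_line.
Qed.

Lemma subv_dim_eq (vT : vectType K) (U V : {vspace vT}) :
  {subset U <= V} -> (\dim V <= \dim U)%N -> U = V.
Proof. by move=> UV dUV; apply/eqP; rewrite eqEdim dUV andbT; apply/subvP. Qed.

Lemma free3 (vT : vectType K) (x y z : vT) (U : {vspace vT}) :
  x \in U -> y \in U -> z \in U -> (\dim U <= 2)%N ->
  exists a b c, [|| a != 0, b != 0 | c != 0] /\ a *: x + b *: y + c *: z = 0.
Proof.
move=> xU yU zU dU; have : ~~ free [:: x; y; z].
  apply/negP => /eqP fr; move: dU; rewrite leqNgt => /negP; apply.
  rewrite -[3%N]fr; apply/dimvS/span_subvP => w; rewrite !inE.
  by case/or3P => /eqP ->.
move=> nf; apply: NNPP => H; case/negP: nf.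
apply/(@freeP _ _ 3 [tuple x; y; z]) => k.
rewrite !big_ord_recl big_ord0 /= addr0 addrA => E i.
have : ~~ [|| k ord0 != 0, k (lift ord0 ord0) != 0 | k (lift ord0 (lift ord0 ord0)) != 0].
  by apply/negP => nz; apply: H; do 3 eexists; split; [exact: nz | exact: E].
rewrite !negb_or !negbK => /and3P [/eqP k0 /eqP k1 /eqP k2].
case: i => [[|[|[|//]]] i3].
- by rewrite -[RHS]k0; congr k; apply: val_inj.
- by rewrite -[RHS]k1; congr k; apply: val_inj.
by rewrite -[RHS]k2; congr k; apply: val_inj.
Qed.
End SmallAlgebras.

(** * Explicit 3 x 3 matrices and the Jordan block case *)

Section Jordan3.
Variable K : fieldType.
Implicit Types (D J : {vspace 'M[K]_3}).

Definition mx3 (s : seq (seq K)) : 'M[K]_3 :=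
  \matrix_(i, j) (nth [::] s i)`_j.

Lemma mx3_eta (x : 'M[K]_3) : exists a b c d e f g h i,
  x = mx3 [:: [:: a; b; c]; [:: d; e; f]; [:: g; h; i]].
Proof.
pose o (k : nat) : 'I_3 := inord k.
exists (x (o 0%N) (o 0%N)), (x (o 0%N) (o 1%N)), (x (o 0%N) (o 2%N)), (x (o 1%N) (o 0%N)),
 (x (o 1%N) (o 1%N)), (x (o 1%N) (o 2%N)), (x (o 2%N) (o 0%N)), (x (o 2%N) (o 1%N)), (x (o 2%N) (o 2%N)).
apply/matrixP => -[[|[|[|//]]] i] [[|[|[|//]]] j]; rewrite mxE /=;
by congr (x _ _); apply: val_inj; rewrite /= inordK.
Qed.

Lemma mx3_inj s t i j : mx3 s = mx3 t -> (i < 3)%N -> (j < 3)%N ->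
  (nth [::] s i)`_j = (nth [::] t i)`_j.
Proof. by move=> /matrixP st i3 j3; have := st (Ordinal i3) (Ordinal j3); rewrite !mxE. Qed.

Lemma C3P (x : 'M[K]_3) :
  reflect (exists a b c, x = mx3 [:: [:: a; b; c]; [:: 0; a; b]; [:: 0; 0; a]]) (x \in C K 3 3).
Proof.
have E3 a b c : a *: 1%:M + b *: (E K 3 1 2 + E K 3 2 3) + c *: E K 3 1 3 =
    mx3 [:: [:: a; b; c]; [:: 0; a; b]; [:: 0; 0; a]].
  apply/matrixP => -[[|[|[|//]]] ?] [[|[|[|//]]] ?]; rewrite !mxE /=;
  by rewrite !(mulr0, mulr1, addr0, add0r).
by apply: (iffP (memv_vline3 _ _ _ _)) => -[a [b [c ->]]]; exists a, b, c; rewrite E3.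
Qed.

Lemma C4P (x : 'M[K]_3) :
  reflect (exists a b c, x = mx3 [:: [:: a; b; 0]; [:: 0; a; 0]; [:: 0; 0; c]]) (x \in C K 4 3).
Proof.
have E3 a b c : a *: (E K 3 1 1 + E K 3 2 2) + b *: E K 3 1 2 + c *: E K 3 3 3 =
    mx3 [:: [:: a; b; 0]; [:: 0; a; 0]; [:: 0; 0; c]].
  apply/matrixP => -[[|[|[|//]]] ?] [[|[|[|//]]] ?]; rewrite !mxE /=;
  by rewrite !(mulr0, mulr1, addr0, add0r).
by apply: (iffP (memv_vline3 _ _ _ _)) => -[a [b [c ->]]]; exists a, b, c; rewrite E3.
Qed.

(** A row [w] not killed by a^2 is cyclic: in the basis w, w a, w a^2 the matrix [a] becomes the
    Jordan block [N]. Everything commuting with [N] is upper triangular with constant diagonals, and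
    equality follows by dimension. *)
Lemma simconj_C3 D a : commutative_subalgebra D -> \dim D = 3%N -> a \in D ->
  a ^+ 2 != 0 -> a ^+ 3 = 0 -> simconj D (C K 3 3).
Proof.
move=> Dc dD aD a2 a3.
have [w wa2] : exists w : 'rV[K]_3, w *m a ^+ 2 != 0.
  apply: NNPP => H; case/negP: a2; apply/eqP/row_matrixP => i.
  rewrite row0 rowE; apply/eqP/negPn/negP => nz; apply: H; eexists; exact: nz.
pose X := \matrix_(i < 3) (w *m a ^+ i).
have wa k : w *m a ^+ (3 + k) = 0 by rewrite exprD a3 mul0r mulmx0.
have uX : X \in unitmx.
  rewrite -row_free_unit -kermx_eq0; apply/rowV0P => y /sub_kermxP yX.
  (* A linear relation among the three rows is multiplied by a^k; taking k = 2, 1, 0 isolates its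
     coefficients one after another. *)
  have H k : \sum_i y 0 i *: (w *m a ^+ (i + k)) = 0.
    transitivity (y *m X *m a ^+ k); last by rewrite yX mul0mx.
    rewrite [y *m X]mulmx_sum_row mulmx_suml.
    by apply: eq_bigr => i _; rewrite rowK -scalemxAl -mulmxA exprD.
  pose o1 : 'I_3 := lift ord0 ord0; pose o2 : 'I_3 := lift ord0 (lift ord0 ord0).
  have {}H k : y 0 ord0 *: (w *m a ^+ k) + y 0 o1 *: (w *m a ^+ k.+1) +
      y 0 o2 *: (w *m a ^+ k.+2) = 0.
    by rewrite -[RHS](H k) !big_ord_recl big_ord0 addr0 addrA.
  have y0 : y 0 ord0 = 0.
    move/eqP: (H 2); rewrite (wa 0%N) (wa 1%N) !scaler0 !addr0.
    by rewrite scaler_eq0 (negPf wa2) orbF => /eqP.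
  have y1 : y 0 o1 = 0.
    move/eqP: (H 1%N); rewrite (wa 0%N) y0 scale0r scaler0 add0r addr0.
    by rewrite scaler_eq0 (negPf wa2) orbF => /eqP.
  have y2 : y 0 o2 = 0.
    move/eqP: (H 0%N); rewrite y0 y1 !scale0r !add0r.
    by rewrite scaler_eq0 (negPf wa2) orbF => /eqP.
  apply/rowP => -[[|[|[|//]]] i]; rewrite mxE.
  - by rewrite -[RHS]y0; congr (y _ _); apply: val_inj.
  - by rewrite -[RHS]y1; congr (y _ _); apply: val_inj.
  by rewrite -[RHS]y2; congr (y _ _); apply: val_inj.
pose N := mx3 [:: [:: 0; 1; 0]; [:: 0; 0; 1]; [:: 0; 0; 0]].
have XN : X *m a = N *m X.
  apply/row_matrixP => i; rewrite !row_mul rowK -mulmxA -[a ^+ i *m a]exprSr [row i N *m X]mulmx_sum_row.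
  rewrite !big_ord_recl big_ord0 !rowK !mxE /=.
  case: i => [[|[|[|//]]] i] /=; rewrite !(scale0r, scale1r, addr0, add0r) //.
  exact: (wa 0%N).
apply: simconj_trans (simconj_conj_vs D uX) _.
have DD := simconj_conj_vs D uX; have [_ AC] := simconj_commutative DD Dc.
suff -> : conj_vs X D = C K 3 3 by apply: simconj_refl.
have NA : N \in conj_vs X D by rewrite mem_conj_vs // -mulmxA -XN mulKmx.
apply: subv_dim_eq; last by rewrite (dim_simconj DD) dD dim_vline3.
move=> x xA; have := AC _ _ xA NA.
have [a00 [a01 [a02 [a10 [a11 [a12 [a20 [a21 [a22 ->]]]]]]]]] := mx3_eta x.
have -> : mx3 [:: [:: a00; a01; a02]; [:: a10; a11; a12]; [:: a20; a21; a22]] *m N =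
    mx3 [:: [:: 0; a00; a01]; [:: 0; a10; a11]; [:: 0; a20; a21]].
  apply/matrixP => -[[|[|[|//]]] i] [[|[|[|//]]] j]; rewrite mxE !big_ord_recl big_ord0 !mxE /=;
  by rewrite !(mulr0, mulr1, addr0, add0r).
have -> : N *m mx3 [:: [:: a00; a01; a02]; [:: a10; a11; a12]; [:: a20; a21; a22]] =
    mx3 [:: [:: a10; a11; a12]; [:: a20; a21; a22]; [:: 0; 0; 0]].
  apply/matrixP => -[[|[|[|//]]] i] [[|[|[|//]]] j]; rewrite mxE !big_ord_recl big_ord0 !mxE /=;
  by rewrite !(mul0r, mul1r, addr0, add0r).
move=> E; have e i j := mx3_inj E (i := i) (j := j).
have /= e1 := e 0%N 0%N isT isT; have /= e2 := e 0%N 1%N isT isT; have /= e3 := e 0%N 2%N isT isT.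
have /= e4 := e 1%N 0%N isT isT; have /= e5 := e 1%N 1%N isT isT; have /= e6 := e 1%N 2%N isT isT.
rewrite -e6 -e5 -e4 -e3 -e2 -e1; apply/C3P; exists a00, a01, a02.
by [].
Qed.
End Jordan3.

(** * Classification of maximum-dimensional commutative subalgebras *)

Section LocalClassification.
Variable K : fieldType.

(** By surjectivity each row of [B1] is the image of one fixed generator under some [b] in J, so J^2
    = 0 makes J kill [B1]. In the basis [X] the ideal J thus consists of upper right blocks, and the
    dimension turns inclusion into equality. *)
Lemma simconj_corner_square_zero m r u (D J : {vspace 'M[K]_m})
  (B0 : 'M[K]_(r, m)) (B1 : 'M[K]_(u, m)) :
  (r + u)%N = m -> (0 < r)%N -> commutative_subalgebra D -> row_full (col_mx B0 B1) ->
  (forall a, a \in D -> exists c, a - c%:M \in J) ->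
  (forall a, a \in J -> (a <= B1)%MS) ->
  (forall phi, exists2 a, a \in J & B0 *m a = phi *m B1) ->
  (forall a b, a \in J -> b \in J -> a *m b = 0) ->
  ((r * u).+1 <= \dim D)%N -> simconj D (corner_algebra K m r).
Proof.
move=> rum; subst m; move=> r0 Dc full DJ JB surj sq dD.
have uX : col_mx B0 B1 \in unitmx by rewrite -row_full_unit.
set X := col_mx B0 B1 in full uX.
have DD := simconj_conj_vs D uX; apply: simconj_trans (DD) _.
suff -> : conj_vs X D = corner_algebra K (r + u) r by apply: simconj_refl.
apply: subv_dim_eq => [x|]; last first.
  by rewrite (dim_simconj DD) dim_corner // ltn_addr.
rewrite mem_conj_vs // => /DJ [c aJ]; set a := _ - c%:M in aJ.
have B1a : B1 *m a = 0.
  apply/row_matrixP => i; have [b bJ Bb] := surj (delta_mx (Ordinal r0) i).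
  rewrite row0 row_mul; have -> : row i B1 *m a = row (Ordinal r0) (B0 *m b) *m a.
    by rewrite Bb row_mul [row _ (delta_mx _ _)]rowE mul_delta_mx -rowE.
  by rewrite -row_mul -mulmxA sq // mulmx0 row0.
pose phi := B0 *m a *m pinvmx B1.
have Xa : X *m a = ur_block phi *m X.
  rewrite mul_col_mx B1a mul_block_col !mul0mx !add0r mulmxKpV //.
  exact: submx_trans (submxMl _ _) (JB _ aJ).
apply/mem_corner_block; exists c, phi.
have -> : x = X *m (c%:M + a) *m invmx X.
  by rewrite addrC subrK !mulmxA mulmxV // mul1mx -mulmxA mulmxV // mulmx1.
rewrite mulmxDr mulmxDl Xa mulmxK //; congr (_ + _).
by rewrite mul_mx_scalar -scalemxAl mulmxV // scalemx1.
Qed.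

Lemma C_corner m r u : (0 < r)%N -> (r + u)%N = m ->
  r = (m./2)%N \/ r = uphalf m ->
  exists2 k, k \in superscripts m & simconj (corner_algebra K m r) (C K k m).
Proof.
move=> r0 rum rE; rewrite /superscripts.
(* For m = 1 the generator count is r = 1 while [C K 1 1] uses m./2 = 0; both corners are empty and
   both algebras are the scalars. *)
have [m1|m1] := eqVneq m 1%N.
  exists 1%N; first by rewrite m1.
  have -> : r = 1%N by lia.
  suff -> : corner_algebra K m 1 = C K 1 m by apply: simconj_refl.
  rewrite /C /corner_algebra; congr (_ + _)%VS; rewrite !big1 // => i.
    by move=> im; exfalso; lia.
  by move=> _; rewrite big1 // => j; have := ltn_ord j; lia.
have [rh|rh] := eqVneq r (m./2)%N.
  exists 1%N; last by rewrite rh; apply: simconj_refl.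
  by do 2 case: ifP => // _.
have {}rE : r = uphalf m by case: rE rh => [->|//]; rewrite eqxx.
have mo : odd m by lia.
exists 2; last by rewrite /C -rE; case: eqP => [m2|_]; [move: mo; rewrite m2 | apply: simconj_refl].
by case: ifP => // /eqP m3; case: ifP => // /negP []; apply/orP; right; lia.
Qed.

(* Every [phi] is the action on the generators of some element of J; if there
   are at least two generators then commutativity kills the action on J K^m:
   compare two elements acting nontrivially on different generators. *)
Lemma square_zero_of_generators m r u (J : {vspace 'M[K]_m})
  (B0 : 'M[K]_(r, m)) (B1 : 'M[K]_(u, m)) :
  (1 < r)%N -> (forall a b, a \in J -> b \in J -> a *m b = b *m a) ->
  (forall phi, exists2 a, a \in J & B0 *m a = phi *m B1) ->
  (forall a, a \in J -> B0 *m a = 0 -> a = 0) ->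
  forall a, a \in J -> (B0 *m a <= B1)%MS -> B1 *m a = 0.
Proof.
move=> r1 Jc surj inj.
have elem i j c a : a \in J -> B0 *m a = (c *: delta_mx i j) *m B1 -> B1 *m a = 0.
  move=> aJ Ba; apply/row_matrixP => j'.
  have [i' ii'] : exists i', i' != i.
    have [i0|i0] := eqVneq (val i) 0%N; last by exists (Ordinal (ltnW r1)); apply: contra i0 => /eqP <-.
    by exists (Ordinal r1); apply/eqP => i1; move: i0; rewrite -i1.
  have [b bJ Bb] := surj (delta_mx i' j').
  (* Row [i'] of B0 a is zero, while row [i'] of B0 b is row [j'] of [B1]; so a b = b a says that
     row [j'] of B1 a is zero. *)
  have := congr1 (row i') (congr1 (mulmx B0) (Jc _ _ aJ bJ)).
  rewrite !mulmxA Ba Bb !row_mul [row i' (_ *: _)]linearZ /= ![row i' (delta_mx _ _)]rowE.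
  rewrite mul_delta_mx mul_delta_mx_0 // scaler0 !mul0mx => /esym.
  by rewrite row0 -rowE.
have all_phi (phi : 'M_(r, u)) : forall a, a \in J -> B0 *m a = phi *m B1 -> B1 *m a = 0.
  rewrite [phi]matrix_sum_delta.
  elim/big_ind: _ => [a aJ|x y IHx IHy a aJ Ba|i _].
  - by rewrite mul0mx => /(inj _ aJ) ->; rewrite mulmx0.
  - have [b bJ Bb] := surj x.
    have ab : B1 *m (a - b) = 0.
      by apply: IHy; rewrite ?rpredB // mulmxBr Ba Bb mulmxDl addrAC subrr add0r.
    by rewrite -[a](subrK b) mulmxDr ab (IHx b) // addr0.
  elim/big_ind: _ => [a aJ|x y IHx IHy a aJ Ba|j _].
  - by rewrite mul0mx => /(inj _ aJ) ->; rewrite mulmx0.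
  - have [b bJ Bb] := surj x.
    have ab : B1 *m (a - b) = 0.
      by apply: IHy; rewrite ?rpredB // mulmxBr Ba Bb mulmxDl addrAC subrr add0r.
    by rewrite -[a](subrK b) mulmxDr ab (IHx b) // addr0.
  by move=> a; apply: elem.
by move=> a aJ /submxP [phi Ba]; apply: (all_phi phi).
Qed.

(** If the nilpotency index n were at least 4, the elements a, a^2, a^3 of J would still be
    dependent. Multiplying the relation by a^(n-2), a^(n-3), a^(n-4) leaves only a^(n-1) each time
    and kills the coefficients in turn. *)
Lemma nilpotent_cube m (J : {vspace 'M[K]_m}) a : (\dim J <= 2)%N ->
  (forall a b, a \in J -> b \in J -> a *m b \in J) ->
  a \in J -> (exists k, a ^+ k = 0) -> a ^+ 3 = 0.
Proof.
move=> dJ JM aJ [k0 ak0]; have : exists k, a ^+ k == 0 by exists k0; rewrite ak0.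
case/ex_minnP => n /eqP an min.
have [n3|n4] := leqP n 3; first by rewrite -(subnKC n3) exprD an mul0r.
have a0 i : (n <= i)%N -> a ^+ i = 0 by move=> ni; rewrite -(subnKC ni) exprD an mul0r.
have a1 : a ^+ n.-1 != 0 by apply/negP => /min; lia.
have aX i : a ^+ i.+1 \in J.
  by elim: i => [|i IH]; rewrite ?expr1 // exprS; apply: JM.
have [x [y [z [nz E]]]] := free3 (aX 0) (aX 1%N) (aX 2) dJ.
have H i : x *: a ^+ (i + 1) + y *: a ^+ (i + 2) + z *: a ^+ (i + 3) = 0.
  have := congr1 (mulmx (a ^+ i)) E.
  by rewrite !mulmxDr -!scalemxAr mulmx0 !mulmxE -!exprD.
have x0 : x = 0.
  move: (H n.-2); rewrite (a0 (n.-2 + 2)%N) ?(a0 (n.-2 + 3)%N); try lia.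
  rewrite !scaler0 !addr0; have -> : (n.-2 + 1 = n.-1)%N by lia.
  by move/eqP; rewrite scaler_eq0 (negPf a1) orbF => /eqP.
have y0 : y = 0.
  move: (H (n - 3)%N); rewrite x0 scale0r add0r (a0 (n - 3 + 3)%N); last by lia.
  rewrite !scaler0 !addr0; have -> : (n - 3 + 2 = n.-1)%N by lia.
  by move/eqP; rewrite scaler_eq0 (negPf a1) orbF => /eqP.
have z0 : z = 0.
  move: (H (n - 4)%N); rewrite x0 y0 !scale0r !add0r.
  have -> : (n - 4 + 3 = n.-1)%N by lia.
  by move/eqP; rewrite scaler_eq0 (negPf a1) orbF => /eqP.
by move: nz; rewrite x0 y0 z0 eqxx.
Qed.

(** In dimension at most 2, a, b and a b are dependent. Multiplying the relation by [b] on the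
    right, or by [a] on the left, leaves a multiple of a b, so the coefficients vanish unless a b =
    0. *)
Lemma products_zero m (J : {vspace 'M[K]_m}) : (\dim J <= 2)%N ->
  (forall a b, a \in J -> b \in J -> a *m b \in J) ->
  (forall a b, a \in J -> b \in J -> a *m b = b *m a) ->
  (forall a, a \in J -> a *m a = 0) ->
  forall a b, a \in J -> b \in J -> a *m b = 0.
Proof.
move=> dJ JM JC sq a b aJ bJ; apply/eqP/negPn/negP => ab0.
have [x [y [z [nz E]]]] := free3 aJ bJ (JM _ _ aJ bJ) dJ.
have x0 : x = 0.
  have := congr1 (mulmxr b) E; rewrite /= !mulmxDl -!scalemxAl -mulmxA sq // mulmx0.
  rewrite !scaler0 !addr0 mul0mx.
  by move/eqP; rewrite scaler_eq0 (negPf ab0) orbF => /eqP.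
have y0 : y = 0.
  have := congr1 (mulmx a) E; rewrite x0 scale0r add0r !mulmxDr -!scalemxAr mulmxA sq //.
  rewrite mul0mx !scaler0 !addr0 mulmx0.
  by move/eqP; rewrite scaler_eq0 (negPf ab0) orbF => /eqP.
move: E nz; rewrite x0 y0 eqxx !scale0r !add0r => /eqP.
by rewrite scaler_eq0 (negPf ab0) orbF => ->.
Qed.

Lemma local_classification m (D : {vspace 'M[K]_m}) : (0 < m)%N ->
  commutative_subalgebra D -> local_subalgebra D -> (quarter_square m < \dim D)%N ->
  exists2 k, k \in superscripts m & simconj D (C K k m).
Proof.
move=> m0 Dc Dl dD; have [Da DC] := Dc.
have [r [u [B0 [B1 [J [rum r0 full [JD Jn] [dJ DJ JM JB inj]]]]]]] :=
  local_generators m0 Dc Dl.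
have JC a b : a \in J -> b \in J -> a *m b = b *m a.
  by move=> aJ bJ; apply: DC; apply: (subvP JD).
have JJ a b : a \in J -> b \in J -> a *m b \in J.
  by move=> aJ bJ; apply: JM => //; apply: (subvP JD).
pose f := linfun (mulmxr (pinvmx B1) \o mulmx B0).
have B0E a : a \in J -> B0 *m a = f a *m B1.
  by move=> aJ; rewrite lfunE /= mulmxKpV // (submx_trans (submxMl _ _)) ?JB.
have fJ : (J :&: lker f = 0)%VS.
  apply/eqP; rewrite -subv0; apply/subvP => a; rewrite memv_cap memv_ker.
  by case/andP => aJ /eqP fa; rewrite (inj a) ?mem0v // B0E // fa mul0mx.
have dfJ : \dim (f @: J) = \dim J by apply: limg_dim_eq.
have rucap : (quarter_square (r + u) <= r * u)%N.
  move: dD; rewrite dJ ltnS rum => /leq_trans; apply.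
  by rewrite -dfJ (leq_trans (dimvS (subvf _))) // dimvf dim_matrix.
have dJru : \dim J = (r * u)%N.
  apply/eqP; rewrite eqn_leq -{1}dfJ (leq_trans (dimvS (subvf _))) ?dimvf ?dim_matrix //=.
  by move: dD (leq_quarter_square r u); rewrite dJ ltnS rum => le /leq_trans; apply.
have surj phi : exists2 a, a \in J & B0 *m a = phi *m B1.
  have /memv_imgP [a aJ phiE] : phi \in (f @: J)%VS.
    suff -> : (f @: J)%VS = fullv by apply: memvf.
    by apply: subv_dim_eq => [x _|]; rewrite ?memvf // dimvf dim_matrix dfJ dJru.
  by exists a; rewrite // phiE B0E.
have [sq|nsq] := classic (forall a b, a \in J -> b \in J -> a *m b = 0).
  have [|k km kC] := @C_corner m r u r0 rum; first by rewrite -rum; apply: eq_quarter_square.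
  exists k => //; apply: simconj_trans kC.
  by apply: (simconj_corner_square_zero rum r0 Dc full DJ JB surj sq); rewrite dJ dJru.
have r1 : r = 1%N.
  apply/eqP; rewrite eqn_leq r0 andbT leqNgt; apply/negP => r1; apply: nsq => a b aJ bJ.
  apply: (inj _ (JJ _ _ aJ bJ)).
  rewrite mulmxA B0E // -mulmxA (square_zero_of_generators r1 JC surj inj bJ) ?mulmx0 //.
  by rewrite B0E // submxMl.
(* [rucap] now reads floor((1 + u)^2 / 4) <= u, which fails from u = 3 on. *)
subst r; have u2 : (u <= 2)%N.
  move: rucap; rewrite mul1n /quarter_square.
  have := odd_double_half (1 + u); rewrite uphalf_half; nia.
have dJ2 : (\dim J <= 2)%N by rewrite dJru mul1n.
have [a aJ a2] : exists2 a, a \in J & a *m a != 0.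
  apply: NNPP => H; apply: nsq; apply: products_zero => // a aJ.
  by apply/eqP/negPn/negP => a2; apply: H; exists a.
have a0 : a != 0 by apply: contraNneq a2 => ->; rewrite mul0mx.
have {}u2 : u = 2%N.
  apply/eqP; rewrite eqn_leq u2 leqNgt; apply/negP => u1.
  (* With dim J <= 1 the square of [a] is a multiple of [a], and nilpotency makes the factor 0. *)
  have Ja : <[a]>%VS = J.
    apply: subv_dim_eq => [x /vlineP [c ->]|]; first exact: memvZ.
    by rewrite dim_vline a0 dJru mul1n; lia.
  have : a *m a \in <[a]>%VS by rewrite Ja JJ.
  case/vlineP => c ac; case/negP: a2.
  by rewrite ac (nilpotent_eigenvalue (Jn _ aJ) a0 ac) scale0r.
subst u; subst m; exists 3%N => //; apply: (@simconj_C3 _ D a) => //.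
- by rewrite dJ dJru.
- exact: (subvP JD).
exact: (nilpotent_cube dJ2 JJ aJ (Jn _ aJ)).
Qed.
End LocalClassification.

Section Classification.
Variable K : closedFieldType.

Lemma idempotent_dims m (D : {vspace 'M[K]_m}) e :
  commutative_subalgebra D -> (quarter_square m < \dim D)%N ->
  e \in D -> e *m e = e -> e != 0 -> e != 1%:M ->
  exists r u, [/\ (r + u)%N = m, r = \rank e, u = \rank (1%:M - e) &
    [/\ (0 < r)%N, (0 < u)%N & (r + u <= 3)%N]].
Proof.
move=> Dc dD eD ee e0 e1; have [r [u [_ [_ [rum _ _ _ [rE uE]]]]]] := idempotent_basis ee.
have r0 : (0 < r)%N by rewrite rE lt0n mxrank_eq0.
have u0 : (0 < u)%N by rewrite uE lt0n mxrank_eq0 subr_eq0 eq_sym.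
exists r, u; split=> //; split=> //.
subst m; have [D1 [D2 [D1c D2c DD]]] := idempotent_split Dc eD ee (esym rE) (esym uE).
apply: quarter_square_split => //; rewrite -ltnS (leq_trans dD) //.
rewrite -(dim_simconj DD) (leq_trans (dim_dsum_leq _ _)) //.
apply: leq_trans (leq_add (dim_commutative r0 D1c) (dim_commutative u0 D2c)) _; lia.
Qed.

Lemma classification2 (D : {vspace 'M[K]_2}) : commutative_subalgebra D ->
  (1 < \dim D)%N -> exists2 k, k \in superscripts 2 & simconj D (C K k 2).
Proof.
move=> Dc dD; have [//|Dl|[e [eD ee e0 e1]]] := local_or_idempotent _ Dc.
  exact: local_classification.
have [r [u [ru rE uE [r0 u0 ru3]]]] := idempotent_dims Dc dD eD ee e0 e1.
have [r1 u1] : r = 1%N /\ u = 1%N by lia.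
subst r u.
have [D1 [D2 [D1c D2c DD]]] := @idempotent_split _ 1 1 D e Dc eD ee r1 u1.
exists 2 => //; suff <- : dsum D1 D2 = C K 2 2 by [].
apply: subv_dim_eq => [x /mem_dsum [a [b [_ _ ->]]]|]; last first.
  by rewrite (dim_simconj DD) (leq_trans (dim_diagonal _ _)).
apply/mem_diagonal => i j; case: (@split_ordP 1 1 i) => i' ->; case: (@split_ordP 1 1 j) => j' ->.
- by rewrite !ord1 eqxx.
- by rewrite block_mxEur mxE.
- by rewrite block_mxEdl mxE.
by rewrite !ord1 eqxx.
Qed.

(** The 1 x 1 summand has dimension at most 1, so the 2 x 2 summand has dimension at least 2 and is
    classified by [classification2]. Its two types yield C^4_3 and C^5_3. *)
Lemma classification21 (D : {vspace 'M[K]_3}) e : commutative_subalgebra D ->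
  (2 < \dim D)%N -> e \in D -> e *m e = e -> \rank e = 2%N -> \rank (1%:M - e) = 1%N ->
  exists2 k, k \in superscripts 3 & simconj D (C K k 3).
Proof.
move=> Dc dD eD ee rE uE.
have [D1 [D2 [D1c D2c DD]]] := @idempotent_split _ 2 1 D e Dc eD ee rE uE.
have dD1 : (1 < \dim D1)%N.
  have dd := dim_dsum_leq D1 D2; rewrite (dim_simconj DD) in dd.
  have d2 : (\dim D2 <= 1)%N by have := dim_commutative (isT : (0 < 1)%N) D2c.
  by move: (leq_trans dD dd); rewrite -ltnS; lia.
have [k k2 kC] := classification2 D1c dD1.
have {}DD := simconj_trans DD (simconj_dsum kC (simconj_refl D2)).
move: k2; rewrite !inE => /orP [] /eqP kE; subst k.
  exists 4 => //; suff <- : dsum (C K 1 2) D2 = C K 4 3 by [].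
  apply: subv_dim_eq; last by rewrite (dim_simconj DD) (leq_trans (dim_vline3 _ _ _)).
  move=> x /mem_dsum [a [b [/(@mem_corner_block _ 1 1) [c [d ->]] _ ->]]].
  apply/C4P; exists c, (d 0 0), (b 0 0); apply/matrixP => i j.
  rewrite [RHS]mxE; case: (@split_ordP 2 1 i) => i' ->; case: (@split_ordP 2 1 j) => j' ->.
  - rewrite (@block_mxEul _ 2 1 2 1) mxE; case: (@split_ordP 1 1 i') => i'' ->; case: (@split_ordP 1 1 j') => j'' ->;
    rewrite !ord1 ?block_mxEul ?block_mxEur ?block_mxEdl ?block_mxEdr !mxE /=;
    by rewrite ?mulr1n ?mulr0n ?addr0 ?add0r.
  - by rewrite (@block_mxEur _ 2 1 2 1) mxE !ord1; case: i' => [[|[|//]] ?].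
  - by rewrite (@block_mxEdl _ 2 1 2 1) mxE !ord1; case: j' => [[|[|//]] ?].
  by rewrite (@block_mxEdr _ 2 1 2 1) !ord1.
exists 5 => //; suff <- : dsum (C K 2 2) D2 = C K 5 3 by [].
apply: subv_dim_eq; last by rewrite (dim_simconj DD) (leq_trans (dim_diagonal _ _)).
move=> x /mem_dsum [a [b [/mem_diagonal ad _ ->]]].
apply/mem_diagonal => i j.
case: (@split_ordP 2 1 i) => i' ->; case: (@split_ordP 2 1 j) => j' ->.
- by rewrite block_mxEul eq_lshift; apply: ad.
- by rewrite block_mxEur mxE.
- by rewrite block_mxEdl mxE.
by rewrite !ord1 eqxx.
Qed.

Theorem classification m (D : {vspace 'M[K]_m}) : (0 < m)%N -> max_dim_commutative D ->
  exists2 k, k \in superscripts m & simconj D (C K k m).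
Proof.
move=> m0 Dmax; have dD : (quarter_square m < \dim D)%N by rewrite dim_max_commutative.
have [Dc _] := Dmax; have [Dl|[e [eD ee e0 e1]]] := local_or_idempotent m0 Dc.
  exact: local_classification.
have [r [u [ru rE uE [r0 u0 ru3]]]] := idempotent_dims Dc dD eD ee e0 e1.
have [m2|m2] := eqVneq m 2%N; first by subst m; move: D Dc dD {Dmax eD ee e0 e1 rE uE e m0}; rewrite m2; apply: classification2.
have m3 : m = 3%N by lia.
have ru3' : (r + u)%N = 3%N by rewrite ru.
clear ru m2; subst m; have [r2|r2] := eqVneq r 2%N.
  by apply: (classification21 Dc dD eD ee); lia.
(* When [e] has rank 1 the complementary idempotent has rank 2 and takes its place. *)
have ff : (1%:M - e) *m (1%:M - e) = 1%:M - e.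
  by rewrite mulmxBl mul1mx mulmxBr mulmx1 ee subrr subr0.
have fD : 1%:M - e \in D by rewrite rpredB // Dc.1.1.
apply: (classification21 Dc dD fD ff); first by lia.
by rewrite opprB addrC subrK; lia.
Qed.
End Classification.

(** * The algebras C^k_m are distinguished by their actions *)

Section Embeddings.
Variable K : fieldType.

(** An injective algebra morphism carried by a function on all matrices, so that composing it or
    cutting out blocks needs no subspace types. *)
Definition embedding m p (S : {vspace 'M[K]_m}) (T : {vspace 'M[K]_p})
    (f : 'M[K]_m -> 'M[K]_p) : Prop :=
  [/\ forall a, a \in S -> f a \in T,
      forall a, a \in S -> f a = 0 -> a = 0,
      f 1%:M = 1%:M
    & forall a b, a \in S -> b \in S -> f (a *m b) = f a *m f b].

Lemma embedding_comp m (S T U : {vspace 'M[K]_m}) f g :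
  embedding S T f -> embedding T U g -> embedding S U (g \o f).
Proof.
move=> [f1 f2 f3 f4] [g1 g2 g3 g4]; split=> /=.
- by move=> a /f1/g1.
- by move=> a aS /g2 => /(_ (f1 _ aS)); apply: f2.
- by rewrite f3.
by move=> a b aS bS; rewrite f4 // g4 // f1.
Qed.

Lemma embedding_dim m p (S : {vspace 'M[K]_m}) (T : {vspace 'M[K]_p})
    (f : {linear 'M[K]_m -> 'M[K]_p}) : embedding S T f ->
  (\dim S <= \dim T)%N /\ ((\dim T <= \dim S)%N ->
     forall b, b \in T -> exists2 a, a \in S & b = f a).
Proof.
case=> fT f0 _ _; have fS : (S :&: lker (linfun f) = 0)%VS.
  apply/eqP; rewrite -subv0; apply/subvP => a; rewrite memv_cap memv_ker lfunE.
  by case/andP => aS /eqP /(f0 _ aS) ->; apply: mem0v.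
have fST : {subset (linfun f @: S)%VS <= T}.
  by move=> _ /memv_imgP [a aS ->]; rewrite lfunE; apply: fT.
have d : \dim (linfun f @: S) = \dim S by apply: limg_dim_eq.
split=> [|dTS b]; first by rewrite -d; apply: dimvS; apply/subvP.
rewrite -(subv_dim_eq fST) ?d // => /memv_imgP [a aS ->]; exists a => //.
by rewrite lfunE.
Qed.
End Embeddings.

Section Links.
Variables (K : fieldType) (m s : nat).
Implicit Types (S T U : {vspace 'M[K]_m}).

(** What remains of an isomorphism of triangular algebras on one diagonal block and on an
    off-diagonal block of width [s] in its block row: [h] intertwines the two left actions. *)
Definition left_linked S T : Prop :=
  exists (f : {linear 'M[K]_m -> 'M[K]_m}) (h : {linear 'M[K]_(m, s) -> 'M[K]_(m, s)}),
  [/\ embedding S T f, forall x, h x = 0 -> x = 0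
    & forall a x, a \in S -> h (a *m x) = f a *m h x].

Definition right_linked S T : Prop :=
  exists (f : {linear 'M[K]_m -> 'M[K]_m}) (h : {linear 'M[K]_(s, m) -> 'M[K]_(s, m)}),
  [/\ embedding S T f, forall x, h x = 0 -> x = 0
    & forall a x, a \in S -> h (x *m a) = h x *m f a].

Definition linked S T : Prop := left_linked S T \/ right_linked S T.

Lemma left_linked_trans S T U : left_linked S T -> left_linked T U -> left_linked S U.
Proof.
move=> [f [h [ef h0 hM]]] [g [k [eg k0 kM]]]; exists (g \o f), (k \o h); split=> /=.
- exact: embedding_comp ef eg.
- by move=> x /k0/h0.
by move=> a x aS; rewrite hM // kM //; case: ef => + _ _ _; apply.
Qed.

Lemma right_linked_trans S T U : right_linked S T -> right_linked T U -> right_linked S U.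
Proof.
move=> [f [h [ef h0 hM]]] [g [k [eg k0 kM]]]; exists (g \o f), (k \o h); split=> /=.
- exact: embedding_comp ef eg.
- by move=> x /k0/h0.
by move=> a x aS; rewrite hM // kM //; case: ef => + _ _ _; apply.
Qed.

Lemma simconj_embedding S T X : X \in unitmx ->
  (forall Y, (Y \in T) = (X *m Y *m invmx X \in S)) ->
  embedding S T (mulmxr X \o mulmx (invmx X)).
Proof.
move=> uX eT.
have XK a : X *m (invmx X *m a *m X) *m invmx X = a.
  by rewrite !mulmxA mulmxV // mul1mx -mulmxA mulmxV // mulmx1.
split=> /= [a aS|a aS a0||a b aS bS].
- by rewrite eT XK.
- by rewrite -[a]XK a0 mulmx0 mul0mx.
- by rewrite mulmx1 mulVmx.
by rewrite !mulmxA -(mulmxA _ X (invmx X)) mulmxV // mulmx1.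
Qed.

Lemma simconj_left_linked S T : simconj S T -> left_linked S T.
Proof.
case=> X uX eT; exists (mulmxr X \o mulmx (invmx X)), (mulmx (invmx X)); split.
- exact: simconj_embedding.
- by move=> x /(congr1 (mulmx X)); rewrite mulmx0 mulKVmx.
by move=> a x _ /=; rewrite !mulmxA -(mulmxA _ X) mulmxV // mulmx1.
Qed.

Lemma simconj_right_linked S T : simconj S T -> right_linked S T.
Proof.
case=> X uX eT; exists (mulmxr X \o mulmx (invmx X)), (mulmxr X); split.
- exact: simconj_embedding.
- by move=> x /= /(congr1 (mulmxr (invmx X))) /=; rewrite mul0mx mulmxK.
by move=> a x _ /=; rewrite !mulmxA -(mulmxA _ X) mulmxV // mulmx1.
Qed.

Lemma linked_embedding S T : linked S T -> exists f : {linear 'M[K]_m -> 'M[K]_m}, embedding S T f.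
Proof. by case=> -[f [h [ef _ _]]]; exists f. Qed.

(** Each of the three properties is inherited along embeddings. Among the C^k_3, [reduced] holds
    only for C^5, [no_cubes] fails only for C^3, and [connected] separates C^1 and C^2 from C^4. *)
Definition reduced S : Prop := forall a, a \in S -> a *m a = 0 -> a = 0.
Definition connected S : Prop := forall a, a \in S -> a *m a = a -> a = 0 \/ a = 1%:M.
Definition no_cubes S : Prop := forall a, a \in S -> a ^+ 3 = 0 -> a *m a = 0.

Section Transfer.
Variables (S T : {vspace 'M[K]_m}).
Hypotheses (Sa : subalgebra S) (ST : linked S T).

Lemma linked_reduced : reduced T -> reduced S.
Proof.
move: ST => /linked_embedding [f [fT f0 f1 fM]] rT a aS a0; apply: f0 => //.
by apply: rT; rewrite ?fT // -fM // a0 linear0.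
Qed.

Lemma linked_connected : connected T -> connected S.
Proof.
move: ST => /linked_embedding [f [fT f0 f1 fM]] cT a aS aa.
have [||/(f0 _ aS)|fa1] := cT (f a); [exact: fT | by rewrite -fM // aa | by left |].
right; apply/eqP; rewrite -subr_eq0; apply/eqP/f0; first by rewrite rpredB // Sa.1.
by rewrite linearB /= fa1 f1 subrr.
Qed.

Lemma linked_no_cubes : no_cubes T -> no_cubes S.
Proof.
move: ST => /linked_embedding [f [fT f0 f1 fM]] cT a aS a3.
have aaS : a *m a \in S by apply: Sa.2.
apply: f0 => //; rewrite fM //; apply: cT; first exact: fT.
have -> : f a ^+ 3 = f (a ^+ 3) by rewrite !exprS !expr0 !mulr1 -!mulmxE !fM.
by rewrite a3 linear0.
Qed.

End Transfer.
End Links.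

(** * Annihilators of corner algebras and the separation of the C^k_m *)

Section CornerInvariant.
Variable K : fieldType.

Lemma corner_nilpotent m r u (a : 'M[K]_m) : (r + u)%N = m -> (0 < u)%N ->
  a \in corner_algebra K m r -> (exists k, a ^+ k = 0) -> a *m a = 0.
Proof.
move=> rum; subst m => u0 /mem_corner_block [c [b aE]] an.
suff c0 : c = 0 by rewrite aE c0 raddf0 add0r ur_block_mul.
(* The last [u] rows of the identity form an eigenmatrix of [a] for its scalar part c; they are
   nonzero because u > 0. *)
apply: (@nilpotent_eigenvalue _ _ u a (row_mx 0 1%:M)) => //.
  rewrite -row_mx0; apply/eqP => /eq_row_mx [_ /matrixP /(_ (Ordinal u0) (Ordinal u0))].
  by rewrite !mxE eqxx => /eqP; rewrite oner_eq0.
rewrite aE mulmxDr mul_mx_scalar -[RHS]addr0; congr (_ + _).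
by rewrite mul_row_block !(mul0mx, mulmx0, addr0) row_mx0.
Qed.

Lemma ur_block_corner r u (b : 'M[K]_(r, u)) : ur_block b \in corner_algebra K (r + u) r.
Proof. by apply/mem_corner_block; exists 0, b; rewrite raddf0 add0r. Qed.

Lemma corner_square_zero r u (a : 'M[K]_(r + u)) : (0 < u)%N ->
  a \in corner_algebra K (r + u) r -> a *m a = 0 -> exists b, a = ur_block b.
Proof.
move=> u0 /mem_corner_block [c [b aE]] aa; exists b; suff c0 : c = 0 by rewrite aE c0 raddf0 add0r.
apply: (@nilpotent_eigenvalue _ _ u a (row_mx 0 1%:M)); first by exists 2; rewrite expr2.
  rewrite -row_mx0; apply/eqP => /eq_row_mx [_ /matrixP /(_ (Ordinal u0) (Ordinal u0))].
  by rewrite !mxE eqxx => /eqP; rewrite oner_eq0.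
rewrite aE mulmxDr mul_mx_scalar -[RHS]addr0; congr (_ + _).
by rewrite mul_row_block !(mul0mx, mulmx0, addr0) row_mx0.
Qed.

(** Square-zero elements are used instead of the corner itself because embeddings respect them. *)
Definition left_annihilated m s (S : {vspace 'M[K]_m}) (x : 'M[K]_(m, s)) : Prop :=
  forall a, a \in S -> a *m a = 0 -> a *m x = 0.
Definition right_annihilated m s (S : {vspace 'M[K]_m}) (x : 'M[K]_(s, m)) : Prop :=
  forall a, a \in S -> a *m a = 0 -> x *m a = 0.

(** The square-zero elements are the upper right blocks, and they see only the lower [u] rows of
    [x]. So exactly the matrices supported on the upper [r] rows are annihilated; on the right it is
    the last [u] columns that survive. *)
Lemma corner_left_annihilated m r u s : (r + u)%N = m -> (0 < r)%N -> (0 < u)%N ->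
  exists2 W : {vspace 'M[K]_(m, s)}, \dim W = (r * s)%N &
    forall x, x \in W <-> left_annihilated (corner_algebra K m r) x.
Proof.
move=> rum; subst m => r0 u0.
pose g := linfun (mulmx (col_mx 1%:M 0 : 'M[K]_(r + u, r)) : 'M_(r, s) -> 'M_(r + u, s)).
exists (g @: fullv)%VS.
  rewrite limg_dim_eq ?dimvf ?dim_matrix //.
  apply/eqP; rewrite -subv0 capfv; apply/subvP => x; rewrite memv_ker lfunE /=.
  rewrite mul_col_mx mul1mx mul0mx -col_mx0 => /eqP /eq_col_mx [-> _]; exact: mem0v.
move=> x; split=> [/memv_imgP [y _ ->] a aS aa|xS].
  have [b ->] := corner_square_zero u0 aS aa.
  by rewrite lfunE /= mulmxA mul_block_col !(mul0mx, mulmx0, addr0) col_mx0 mul0mx.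
apply/memv_imgP; exists (usubmx x); rewrite ?memvf // lfunE /= mul_col_mx mul1mx mul0mx.
rewrite -{1}[x]vsubmxK; congr col_mx; apply/row_matrixP => j.
have := xS _ (ur_block_corner (delta_mx (Ordinal r0) j)) (ur_block_mul _ _).
rewrite -{1}[x]vsubmxK mul_block_col !mul0mx add0r addr0 -col_mx0 => /eq_col_mx [].
by move=> /(congr1 (row (Ordinal r0))); rewrite row_mul [row _ (delta_mx _ _)]rowE mul_delta_mx -rowE !row0.
Qed.

Lemma corner_right_annihilated m r u s : (r + u)%N = m -> (0 < r)%N -> (0 < u)%N ->
  exists2 W : {vspace 'M[K]_(s, m)}, \dim W = (s * u)%N &
    forall x, x \in W <-> right_annihilated (corner_algebra K m r) x.
Proof.
move=> rum; subst m => r0 u0.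
pose g := linfun (mulmxr (row_mx 0 1%:M : 'M[K]_(u, r + u)) : 'M_(s, u) -> 'M_(s, r + u)).
exists (g @: fullv)%VS.
  rewrite limg_dim_eq ?dimvf ?dim_matrix //.
  apply/eqP; rewrite -subv0 capfv; apply/subvP => x; rewrite memv_ker lfunE /=.
  rewrite mul_mx_row mulmx1 mulmx0 -row_mx0 => /eqP /eq_row_mx [_ ->]; exact: mem0v.
move=> x; split=> [/memv_imgP [y _ ->] a aS aa|xS].
  have [b ->] := corner_square_zero u0 aS aa.
  by rewrite lfunE /= -mulmxA mul_row_block !(mul0mx, mulmx0, addr0) row_mx0 mulmx0.
apply/memv_imgP; exists (rsubmx x); rewrite ?memvf // lfunE /= mul_mx_row mulmx1 mulmx0.
rewrite -{1}[x]hsubmxK; congr row_mx; apply/trmx_inj/row_matrixP => i.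
have := xS _ (ur_block_corner (delta_mx i (Ordinal u0))) (ur_block_mul _ _).
rewrite -{1}[x]hsubmxK mul_row_block !mulmx0 !addr0 -row_mx0 => /eq_row_mx [_].
move=> /(congr1 trmx); rewrite trmx_mul trmx_delta => /(congr1 (row (Ordinal u0))).
by rewrite row_mul [row _ (delta_mx _ _)]rowE mul_delta_mx -rowE !trmx0 !row0.
Qed.

Lemma corner_mul m r u a b : (r + u)%N = m -> a \in corner_algebra K m r ->
  b \in corner_algebra K m r -> a *m b \in corner_algebra K m r.
Proof. by move=> rum; subst m; apply: (corner_commutative K r u).1.2. Qed.

(** The dimension hypothesis makes [f] onto, so every square-zero element of the target comes from
    one of the source. Hence [h] maps annihilated matrices to annihilated ones, and r s <= r' s. *)
Lemma left_linked_corner m r u r' u' s :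
  (r + u)%N = m -> (r' + u')%N = m -> (0 < s)%N ->
  [&& 0 < r, 0 < u, 0 < r' & 0 < u']%N ->
  (\dim (corner_algebra K m r') <= \dim (corner_algebra K m r))%N ->
  left_linked s (corner_algebra K m r) (corner_algebra K m r') -> (r <= r')%N.
Proof.
move=> ru ru' s0 /and4P[r0 u0 r0' u0'] d [f [h [ef h0 hM]]].
have [W dW WP] := corner_left_annihilated s ru r0 u0.
have [W' dW' WP'] := corner_left_annihilated s ru' r0' u0'.
rewrite -(leq_pmul2r s0) -dW -dW'; have hW : (W :&: lker (linfun h) = 0)%VS.
  apply/eqP; rewrite -subv0; apply/subvP => a; rewrite memv_cap memv_ker lfunE.
  by case/andP => _ /eqP /h0 ->; apply: mem0v.
rewrite -(limg_dim_eq hW); apply/dimvS/subvP => _ /memv_imgP [x /WP xW ->].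
rewrite lfunE; apply/WP' => b bT bb; have [_ /(_ d _ bT) [a aS bE]] := embedding_dim ef.
case: ef => fT f0 _ fM; rewrite bE -hM // xW ?linear0 //.
by apply: f0; [exact: (corner_mul ru) | rewrite fM // -bE bb].
Qed.

Lemma right_linked_corner m r u r' u' s :
  (r + u)%N = m -> (r' + u')%N = m -> (0 < s)%N ->
  [&& 0 < r, 0 < u, 0 < r' & 0 < u']%N ->
  (\dim (corner_algebra K m r') <= \dim (corner_algebra K m r))%N ->
  right_linked s (corner_algebra K m r) (corner_algebra K m r') -> (u <= u')%N.
Proof.
move=> ru ru' s0 /and4P[r0 u0 r0' u0'] d [f [h [ef h0 hM]]].
have [W dW WP] := corner_right_annihilated s ru r0 u0.
have [W' dW' WP'] := corner_right_annihilated s ru' r0' u0'.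
rewrite -(leq_pmul2l s0) -dW -dW'; have hW : (W :&: lker (linfun h) = 0)%VS.
  apply/eqP; rewrite -subv0; apply/subvP => a; rewrite memv_cap memv_ker lfunE.
  by case/andP => _ /eqP /h0 ->; apply: mem0v.
rewrite -(limg_dim_eq hW); apply/dimvS/subvP => _ /memv_imgP [x /WP xW ->].
rewrite lfunE; apply/WP' => b bT bb; have [_ /(_ d _ bT) [a aS bE]] := embedding_dim ef.
case: ef => fT f0 _ fM; rewrite bE -hM // xW ?linear0 //.
by apply: f0; [exact: (corner_mul ru) | rewrite fM // -bE bb].
Qed.

(* Both sides are needed: in a block triangular algebra the first diagonal block
   acts only from the left on the blocks M_(n_i x n_j), i < j, the last one only
   from the right. *)
Definition bilinked m s (S T : {vspace 'M[K]_m}) : Prop :=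
  (left_linked s S T /\ left_linked s T S) \/ (right_linked s S T /\ right_linked s T S).

Lemma bilinked_sym m s (S T : {vspace 'M[K]_m}) : bilinked s S T -> bilinked s T S.
Proof. by case=> -[H1 H2]; [left|right]. Qed.

Lemma bilinked_linked m s (S T : {vspace 'M[K]_m}) : bilinked s S T -> linked s S T.
Proof. by case=> -[H1 H2]; [left|right]. Qed.

Lemma bilinked_simconj m s (S S' T T' : {vspace 'M[K]_m}) : simconj S S' -> simconj T T' ->
  bilinked s S T -> bilinked s S' T'.
Proof.
move=> SS' TT' [[H1 H2]|[H1 H2]]; [left|right]; split.
- apply: left_linked_trans (simconj_left_linked s (simconj_sym SS')) _.
  exact: left_linked_trans H1 (simconj_left_linked s TT').
- apply: left_linked_trans (simconj_left_linked s (simconj_sym TT')) _.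
  exact: left_linked_trans H2 (simconj_left_linked s SS').
- apply: right_linked_trans (simconj_right_linked s (simconj_sym SS')) _.
  exact: right_linked_trans H1 (simconj_right_linked s TT').
apply: right_linked_trans (simconj_right_linked s (simconj_sym TT')) _.
exact: right_linked_trans H2 (simconj_right_linked s SS').
Qed.

Lemma simconj_bilinked m s (S T : {vspace 'M[K]_m}) : simconj S T -> bilinked s S T.
Proof.
by move=> ST; left; split; apply: simconj_left_linked => //; apply: simconj_sym.
Qed.

Lemma bilinked_corner m r u r' u' s :
  (r + u)%N = m -> (r' + u')%N = m -> (0 < s)%N ->
  [&& 0 < r, 0 < u, 0 < r' & 0 < u']%N ->
  bilinked s (corner_algebra K m r) (corner_algebra K m r') -> r = r'.
Proof.
move=> ru ru' s0 pos ST; have /and4P [p1 p2 p3 p4] := pos.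
have pos' : [&& 0 < r', 0 < u', 0 < r & 0 < u]%N by apply/and4P.
have [f /embedding_dim [d1 _]] := linked_embedding (bilinked_linked ST).
have [g /embedding_dim [d2 _]] := linked_embedding (bilinked_linked (bilinked_sym ST)).
case: ST => -[H1 H2]; apply/eqP; rewrite eqn_leq.
  by rewrite (left_linked_corner ru ru' s0 pos d2 H1) (left_linked_corner ru' ru s0 pos' d1 H2).
have := right_linked_corner ru ru' s0 pos d2 H1.
by have := right_linked_corner ru' ru s0 pos' d1 H2; lia.
Qed.

Lemma corner_connected m r u : (r + u)%N = m -> (0 < u)%N ->
  connected (corner_algebra K m r).
Proof.
move=> rum; subst m => u0 a /mem_corner_block [c [b aE]] aa.
pose Z : 'M[K]_(u, r + u) := row_mx 0 1%:M.
have Z0 : Z != 0.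
  rewrite -row_mx0; apply/eqP => /eq_row_mx [_ /matrixP /(_ (Ordinal u0) (Ordinal u0))].
  by rewrite !mxE eqxx => /eqP; rewrite oner_eq0.
have Za : Z *m a = c *: Z.
  rewrite aE mulmxDr mul_mx_scalar -[RHS]addr0; congr (_ + _).
  by rewrite mul_row_block !(mul0mx, mulmx0, addr0) row_mx0.
have : c * c = c.
  have := congr1 (mulmx Z) aa; rewrite mulmxA !Za -scalemxAl Za scalerA => /eqP.
  by rewrite -subr_eq0 -scalerBl scaler_eq0 (negPf Z0) orbF subr_eq0 => /eqP.
move/eqP; rewrite -subr_eq0 -{3}[c]mulr1 -mulrBr mulf_eq0 subr_eq0 => /orP[] /eqP c0.
  by left; rewrite -aa aE c0 raddf0 add0r ur_block_mul.
right; rewrite aE c0; suff -> : ur_block b = 0 by rewrite addr0.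
move: aa; rewrite aE c0 mulmxDl mul1mx mulmxDr mulmx1 ur_block_mul addr0.
by move=> aa; apply: (addrI (1%:M + ur_block b)); rewrite addr0.
Qed.

Lemma corner_no_cubes m r u : (r + u)%N = m -> (0 < u)%N ->
  no_cubes (corner_algebra K m r).
Proof. by move=> rum u0 a aS a3; apply: (corner_nilpotent rum u0 aS); exists 3%N. Qed.

Lemma corner_not_reduced m r u : (r + u)%N = m -> (0 < r)%N -> (0 < u)%N ->
  ~ reduced (corner_algebra K m r).
Proof.
move=> rum; subst m => r0 u0 red.
have := red _ (ur_block_corner (delta_mx (Ordinal r0) (Ordinal u0))) (ur_block_mul _ _).
rewrite -block_mx0 => /eq_block_mx [_ /matrixP /(_ (Ordinal r0) (Ordinal u0))].
by rewrite !mxE !eqxx => /eqP; rewrite oner_eq0.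
Qed.

Lemma diagonal_reduced m : reduced (diagonal_algebra K m).
Proof.
move=> a /mem_diagonal ad /matrixP aa; apply/matrixP => i j; rewrite mxE.
have [->|/ad//] := eqVneq i j; have := aa j j; rewrite !mxE (bigD1 j) //= big1 ?addr0.
  by move/eqP; rewrite mulf_eq0 orbb => /eqP.
by move=> k kj; rewrite ad ?mul0r // eq_sym.
Qed.

Lemma reduced_no_cubes m (S : {vspace 'M[K]_m}) : subalgebra S -> reduced S -> no_cubes S.
Proof.
move=> [_ SM] red a aS a3; apply: red; first exact: SM.
by rewrite !mulmxE -!expr2 -exprM exprS a3 mulr0.
Qed.

Lemma C3_not_no_cubes : ~ no_cubes (C K 3 3).
Proof.
pose N := mx3 [:: [:: 0; 1 : K; 0]; [:: 0; 0; 1]; [:: 0; 0; 0]].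
have NC : N \in C K 3 3 by apply/C3P; exists 0, 1, 0.
have N2 : N *m N = mx3 [:: [:: 0; 0; 1 : K]; [:: 0; 0; 0]; [:: 0; 0; 0]].
  apply/matrixP => -[[|[|[|//]]] i] [[|[|[|//]]] j]; rewrite mxE !big_ord_recl big_ord0 !mxE /=;
  by rewrite !(mulr0, mulr1, addr0, add0r).
move=> /(_ N NC); rewrite !exprS expr0 mulr1 -!mulmxE N2 => H.
suff /H /matrixP /(_ ord0 (Ordinal (isT : 2 < 3)%N)) :
    N *m mx3 [:: [:: 0; 0; 1 : K]; [:: 0; 0; 0]; [:: 0; 0; 0]] = 0.
  by rewrite !mxE /= => /eqP; rewrite oner_eq0.
apply/matrixP => -[[|[|[|//]]] i] [[|[|[|//]]] j]; rewrite mxE !big_ord_recl big_ord0 !mxE /=;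
by rewrite !(mulr0, mul0r, addr0, add0r).
Qed.

Lemma C4_not_reduced : ~ reduced (C K 4 3).
Proof.
pose a := mx3 [:: [:: 0; 1 : K; 0]; [:: 0; 0; 0]; [:: 0; 0; 0]].
move=> red; suff /matrixP /(_ ord0 (Ordinal (isT : 1 < 3)%N)) : a = 0.
  by rewrite !mxE /= => /eqP; rewrite oner_eq0.
apply: red; first by apply/C4P; exists 0, 1, 0.
apply/matrixP => -[[|[|[|//]]] i] [[|[|[|//]]] j]; rewrite mxE !big_ord_recl big_ord0 !mxE /=;
by rewrite !(mulr0, mul0r, addr0, add0r).
Qed.

Lemma C4_not_connected : ~ connected (C K 4 3).
Proof.
pose a := mx3 [:: [:: 0; 0 : K; 0]; [:: 0; 0; 0]; [:: 0; 0; 1]].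
move=> con; suff [/matrixP /(_ ord_max ord_max)|/matrixP /(_ ord0 ord0)] : a = 0 \/ a = 1%:M.
- by rewrite !mxE /= => /eqP; rewrite oner_eq0.
- by rewrite !mxE /= => /eqP; rewrite eq_sym oner_eq0.
apply: con; first by apply/C4P; exists 0, 0, 1.
apply/matrixP => -[[|[|[|//]]] i] [[|[|[|//]]] j]; rewrite mxE !big_ord_recl big_ord0 !mxE /=;
by rewrite !(mulr0, mulr1, mul0r, addr0, add0r).
Qed.

Lemma C4_no_cubes : no_cubes (C K 4 3).
Proof.
move=> a /C4P [x [y [z aE]]] a3; have an : exists k, a ^+ k = 0 by exists 3%N.
have x0 : x = 0.
  apply: (@nilpotent_eigenvalue _ _ 1 a (delta_mx 0 (Ordinal (isT : 1 < 3)%N))) => //.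
    by apply/eqP => /matrixP /(_ 0 (Ordinal (isT : 1 < 3)%N)); rewrite !mxE !eqxx => /eqP; rewrite oner_eq0.
  rewrite -rowE aE; apply/rowP => -[[|[|[|//]]] i]; rewrite !mxE /=;
  by rewrite ?mulr0 ?mulr1.
have z0 : z = 0.
  apply: (@nilpotent_eigenvalue _ _ 1 a (delta_mx 0 (Ordinal (isT : 2 < 3)%N))) => //.
    by apply/eqP => /matrixP /(_ 0 (Ordinal (isT : 2 < 3)%N)); rewrite !mxE !eqxx => /eqP; rewrite oner_eq0.
  rewrite -rowE aE; apply/rowP => -[[|[|[|//]]] i]; rewrite !mxE /=;
  by rewrite ?mulr0 ?mulr1.
rewrite aE x0 z0.
apply/matrixP => -[[|[|[|//]]] i] [[|[|[|//]]] j]; rewrite mxE !big_ord_recl big_ord0 !mxE /=;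
by rewrite !(mulr0, mul0r, addr0, add0r).
Qed.

Lemma C_bilinked_inj m s k k' : (0 < s)%N -> k \in superscripts m -> k' \in superscripts m ->
  subalgebra (C K k m) -> subalgebra (C K k' m) ->
  bilinked s (C K k m) (C K k' m) -> k = k'.
Proof.
move=> s0; wlog lt : k k' / (k < k')%N.
  move=> H km km' Ck Ck' kk'; have [lt|lt|//] := ltngtP k k'; first exact: H.
  by apply/esym; apply: H => //; apply: bilinked_sym.
move=> km km' Ck Ck' kk'; exfalso.
have l1 := bilinked_linked kk'; have l2 := bilinked_linked (bilinked_sym kk').
move: km km'; rewrite /superscripts.
have [m3|m3] := eqVneq m 3%N.
  subst m; have c1 : C K 1 3 = corner_algebra K 3 1 by [].
  have c2 : C K 2 3 = corner_algebra K 3 2 by [].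
  have r5 : reduced (C K 5 3) by apply: diagonal_reduced.
  have n1 : no_cubes (C K 1 3) by rewrite c1; apply: (@corner_no_cubes 3 1 2).
  have n2 : no_cubes (C K 2 3) by rewrite c2; apply: (@corner_no_cubes 3 2 1).
  have g1 : connected (C K 1 3) by rewrite c1; apply: (@corner_connected 3 1 2).
  have g2 : connected (C K 2 3) by rewrite c2; apply: (@corner_connected 3 2 1).
  have q1 : ~ reduced (C K 1 3) by rewrite c1; apply: (@corner_not_reduced 3 1 2).
  have q2 : ~ reduced (C K 2 3) by rewrite c2; apply: (@corner_not_reduced 3 2 1).
  have := C3_not_no_cubes; have := C4_not_reduced; have := C4_not_connected; have := C4_no_cubes.
  rewrite !inE => n4 g4 q4 n3.
  have red : reduced (C K k' 3) -> reduced (C K k 3) by apply: linked_reduced l1.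
  have con : connected (C K k 3) -> connected (C K k' 3) by apply: linked_connected l2.
  have cub : no_cubes (C K k 3) -> no_cubes (C K k' 3) by apply: linked_no_cubes l2.
  have cub' : no_cubes (C K k' 3) -> no_cubes (C K k 3) by apply: linked_no_cubes l1.
  (* Only C^1 against C^2 needs the linked actions; all other pairs differ in one of the three
     ring-theoretic properties. *)
  move=> /or4P [/eqP?|/eqP?|/eqP?|/orP[]/eqP?] /or4P [/eqP?|/eqP?|/eqP?|/orP[]/eqP?]; subst k k' => //; auto.
  - have := @bilinked_corner 3 1 2 2 1 s erefl erefl s0 erefl; rewrite -c1 -c2 => /(_ kk').
    by [].
  by apply/n3/cub'/reduced_no_cubes.
have [m2|m2] /= := eqVneq m 2%N.
  rewrite !inE => km km'; have [ke ke'] : k = 1%N /\ k' = 2%N by lia.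
  subst m k k'; apply: (@corner_not_reduced 2 1 1) => //.
  by apply: (linked_reduced l1); apply: diagonal_reduced.
case: ifP => [/andP[m5 mo]|_]; last by rewrite !inE; lia.
rewrite !inE => km km'; have [ke ke'] : k = 1%N /\ k' = 2%N by lia.
subst k k'; move: kk'; rewrite /C (negPf m2) => kk'.
have := @bilinked_corner m m./2 (uphalf m) (uphalf m) m./2 s.
by move=> /(_ _ _ s0 _ kk'); lia.
Qed.
End CornerInvariant.

(** * Block triangular algebras *)

(* [R i] and [C j] are the rows and columns of the identity matrix selecting a
   block: the (i, j) block of x is [R i *m x *m C j]. *)
Definition frame (K : fieldType) q N (n : 'I_q -> nat)
    (R : forall i, 'M[K]_(n i, N)) (C : forall i, 'M[K]_(N, n i)) : Prop :=
  [/\ forall i, R i *m C i = 1%:M, forall i j, i != j -> R i *m C j = 0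
    & \sum_i C i *m R i = 1%:M].

(** Turns blocks, with their casts, into plain matrix products, so that later arguments use only the
    identities of a frame. *)
Lemma block_frame (K : fieldType) q N (n : q.-tuple nat) (hn : (\sum_(i < q) tnth n i)%N = N) :
  exists R C, frame (K := K) (n := tnth n) R C /\
    forall (x : 'M[K]_N) i j, block hn x i j = R i *m x *m C j.
Proof.
subst N; pose S := (\sum_(i < q) tnth n i)%N.
pose R i : 'M[K]_(tnth n i, S) := rowsub (tagnat.Rank i) 1%:M.
pose C i : 'M[K]_(S, tnth n i) := colsub (tagnat.Rank i) 1%:M.
have RC i j : R i *m C j = mxsub (tagnat.Rank i) (tagnat.Rank j) 1%:M.
  by rewrite -mxsub_mul mul1mx.
exists R, C; split; first split.
- by move=> i; rewrite RC; apply/matrixP => a b; rewrite !mxE -val_eqE tagnat.eq_Rank eqxx.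
- by move=> i j ij; rewrite RC; apply/matrixP => a b; rewrite !mxE -val_eqE tagnat.eq_Rank (negPf ij).
- have e1 : \mxrow_j C j = 1%:M :> 'M_S by exact: submxrowK.
  have e2 : \mxcol_i R i = 1%:M :> 'M_S by exact: submxcolK.
  by rewrite -mul_mxrow_mxcol e1 e2 mul1mx.
move=> x i j; rewrite /block /submxblock !castmx_id.
by rewrite -{1}[x]mulmx1 mxsub_mul -{1}[x]mul1mx -mul_rowsub_mx.
Qed.

Lemma prod_rcons_mx (K : fieldType) N (s : seq 'M[K]_N) z :
  \prod_(y <- rcons s z) y = \prod_(y <- s) y *m z.
Proof. by rewrite -cats1 big_cat big_seq1. Qed.

Lemma prod_cons_mx (K : fieldType) N (s : seq 'M[K]_N) z :
  \prod_(y <- z :: s) y = z *m \prod_(y <- s) y.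
Proof. by rewrite big_cons. Qed.

Section Frame.
Variables (K : fieldType) (q N : nat) (n : 'I_q -> nat).
Variables (R : forall i, 'M[K]_(n i, N)) (C : forall i, 'M[K]_(N, n i)).
Hypothesis RC : frame R C.
Implicit Types (x y : 'M[K]_N).

Lemma frame_mul x y i j :
  R i *m (x *m y) *m C j = \sum_k (R i *m x *m C k) *m (R k *m y *m C j).
Proof.
case: RC => _ _ E; rewrite -[x in LHS]mulmx1 -E mulmx_sumr mulmx_suml mulmx_sumr mulmx_suml.
by apply: eq_bigr => k _; rewrite !mulmxA.
Qed.

Lemma frame_sum x : x = \sum_i \sum_j C i *m (R i *m x *m C j) *m R j.
Proof.
case: RC => _ _ E; rewrite -{1}[x]mul1mx -{1}[_ *m x]mulmx1 -E !mulmx_suml.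
apply: eq_bigr => i _; rewrite mulmx_sumr; apply: eq_bigr => j _.
by rewrite !mulmxA.
Qed.

(** The filtration by block superdiagonals: [k = 0] is block upper triangular, [k = 1] strictly so,
    and degrees add under products. *)
Definition upper (k : nat) x : Prop := forall i j : 'I_q, (j < i + k)%N -> R i *m x *m C j = 0.

Lemma upper_mul k l x y : upper k x -> upper l y -> upper (k + l) (x *m y).
Proof.
move=> xk yl i j ij; rewrite frame_mul big1 // => p _.
have [pk|pk] := ltnP p (i + k); first by rewrite xk // mul0mx.
by rewrite [X in _ *m X]yl ?mulmx0 //; lia.
Qed.

Lemma upper1 : upper 0 1%:M.
Proof.
case: RC => _ E _ i j ij; rewrite mulmx1 E //.
by apply/eqP => ijE; move: ij; rewrite ijE addn0 ltnn.
Qed.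

Lemma frame_diag_mul x y i : upper 0 x -> upper 0 y ->
  R i *m (x *m y) *m C i = (R i *m x *m C i) *m (R i *m y *m C i).
Proof.
move=> ux uy; rewrite frame_mul (bigD1 i) //= big1 ?addr0 // => p pi.
have [lt|gt|E] := ltngtP p i; first by rewrite ux ?addn0 // mul0mx.
  by rewrite [X in _ *m X]uy ?addn0 // mulmx0.
by case/eqP: pi; apply: val_inj.
Qed.

(** A nonzero term of the (j, k) block follows a path j, r, p, k with r >= j + i, p >= r and k >= p
    + (q - 1 - i). As k <= q - 1, this forces r = p = i, so [a] enters only through its (i, i)
    block, which is zero. Indices start at 0. *)
Lemma upper_sandwich (i : 'I_q) x a y : upper 0 a -> R i *m a *m C i = 0 ->
  upper i x -> upper (q.-1 - i) y -> x *m a *m y = 0.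
Proof.
move=> au a0 xu yu; rewrite (frame_sum (_ *m _)) big1 // => j _; rewrite big1 // => k _.
suff -> : R j *m (x *m a *m y) *m C k = 0 by rewrite mulmx0 mul0mx.
rewrite frame_mul big1 // => p _; have [kp|pk] := ltnP k (p + (q.-1 - i)).
  by rewrite [X in _ *m X]yu // mulmx0.
rewrite frame_mul big1 ?mul0mx // => r _; have [rj|jr] := ltnP r (j + i).
  by rewrite xu // mul0mx.
have [pr|rp] := ltnP p r; first by rewrite [X in _ *m X]au ?addn0 // mulmx0.
have ri : r = i by apply: val_inj => /=; have := ltn_ord k; have := ltn_ord i; lia.
have pi : p = i by apply: val_inj => /=; have := ltn_ord k; have := ltn_ord i; lia.
by subst r p; rewrite a0 mulmx0.
Qed.

Variables (D : forall i, {vspace 'M[K]_(n i)}) (A : {vspace 'M[K]_N}).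

Definition triangular_algebra : Prop :=
  [/\ subalgebra A, forall i, commutative_subalgebra (D i)
    & forall x, x \in A <-> (forall i, R i *m x *m C i \in D i) /\ upper 0 x].

Hypothesis AT : triangular_algebra.

Lemma triangular_upper x : x \in A -> upper 0 x.
Proof. by case: AT => _ _ AE /AE []. Qed.

Lemma triangular_diag x i : x \in A -> R i *m x *m C i \in D i.
Proof. by case: AT => _ _ AE /AE []. Qed.

Lemma frame_unit i j p k (x : 'M_(n i, n j)) :
  R p *m (C i *m x *m R j) *m C k = (R p *m C i) *m x *m (R j *m C k).
Proof. by rewrite !mulmxA. Qed.

Lemma strict_unit_mem (i j : 'I_q) (x : 'M_(n i, n j)) : (i < j)%N ->
  C i *m x *m R j \in A /\ upper 1 (C i *m x *m R j).
Proof.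
case: RC => RC1 RC0 _ ij.
have H (p k : 'I_q) : (k <= p)%N -> R p *m (C i *m x *m R j) *m C k = 0.
  move=> kp; rewrite frame_unit; have [pi|pi] := eqVneq p i; last by rewrite RC0 // !mul0mx.
  by subst p; rewrite (RC0 j) ?mulmx0 //; apply/eqP => jk; subst k; lia.
split; last by move=> p k; rewrite addn1 ltnS; apply: H.
case: AT => _ Dc ->; split=> [p|p k]; first by rewrite H // mem0v.
by rewrite addn0 => /ltnW; apply: H.
Qed.

Lemma diag_unit_mem (i : 'I_q) (x : 'M_(n i)) : x \in D i -> C i *m x *m R i \in A.
Proof.
case: RC => RC1 RC0 _ xD; case: AT => _ Dc ->; split=> [p|p k].
  rewrite frame_unit; have [pi|pi] := eqVneq p i; last by rewrite RC0 // !mul0mx mem0v.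
  by subst p; rewrite RC1 mul1mx mulmx1.
rewrite addn0 => kp; rewrite frame_unit; have [pi|pi] := eqVneq p i; last by rewrite RC0 // !mul0mx.
by subst p; rewrite (RC0 i k) ?mulmx0 //; apply/eqP => ik; subst k; lia.
Qed.

Lemma idempotent_mem i : C i *m R i \in A.
Proof.
by rewrite -[C i]mulmx1; apply: diag_unit_mem; case: AT => _ /(_ i) [[]].
Qed.

Definition strict x : Prop := x \in A /\ upper 1 x.

Lemma prod_upper (s : seq 'M[K]_N) : (forall z, z \in s -> strict z) ->
  \prod_(z <- s) z \in A /\ upper (size s) (\prod_(z <- s) z).
Proof.
elim: s => [|z s IH] sS; first by rewrite big_nil; split; [case: AT => -[] | exact: upper1].
have [zA zu] := sS z (mem_head _ _).
have [|sA su] := IH; first by move=> y ys; apply: sS; rewrite inE ys orbT.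
rewrite prod_cons_mx; split; last exact: (upper_mul zu su).
by case: AT => -[_ AM] _ _; apply: AM.
Qed.

Hypothesis n_gt0 : forall i, (0 < n i)%N.

(** A chain of rank-one strictly upper elements leads from block 0 through 1, 2, ... to [i], passing
    through coordinate 0 of each intermediate block. With [right_path] this gives the converse of
    [upper_sandwich]: every entry of the (i, i) block shows up in T^i a T^(q-1-i). *)
Lemma left_path (i0 : 'I_q) : nat_of_ord i0 = 0%N -> forall k (i : 'I_q), nat_of_ord i = k ->
  forall rho : 'rV_(n i), exists s, [/\ size s = k, forall z, z \in s -> strict z &
    exists p : 'rV_(n i0), p *m R i0 *m \prod_(z <- s) z = rho *m R i].
Proof.
case: RC => RC1 _ _ i00; elim=> [|k IH] i ik rho.
  have ii0 : i = i0 by apply: val_inj; rewrite /= ik i00.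
  subst i; exists [::]; split=> //; exists rho; by rewrite big_nil mulmx1.
have kq : (k < q)%N by have := ltn_ord i; lia.
pose j := Ordinal kq; pose a := Ordinal (n_gt0 j).
have [s [sk sS [p ps]]] := IH j erefl (delta_mx 0 a).
have ji : (j < i)%N by rewrite /= ik.
exists (rcons s (C j *m (delta_mx a 0 *m rho) *m R i)); split.
- by rewrite size_rcons sk.
- move=> z; rewrite mem_rcons inE => /orP[/eqP->|/sS //].
  exact: (strict_unit_mem (delta_mx a 0 *m rho) ji).
exists p; rewrite prod_rcons_mx mulmxA ps.
rewrite !mulmxA -(mulmxA _ (R j)) RC1 mulmx1 mul_delta_mx.
by rewrite (_ : delta_mx 0 0 = 1%:M) ?mul1mx //; apply/matrixP => x y; rewrite !ord1 !mxE.
Qed.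

Lemma right_path (il : 'I_q) : (nat_of_ord il).+1 = q -> forall k (i : 'I_q), (i + k.+1)%N = q ->
  forall tau : 'cV_(n i), exists s, [/\ size s = k, forall z, z \in s -> strict z &
    exists c : 'cV_(n il), \prod_(z <- s) z *m C il *m c = C i *m tau].
Proof.
case: RC => RC1 _ _ ilq; elim=> [|k IH] i ik tau.
  have iil : i = il by apply: val_inj => /=; lia.
  subst i; exists [::]; split=> //; exists tau; by rewrite big_nil mul1mx.
have kq : (i.+1 < q)%N by lia.
pose j := Ordinal kq; pose a := Ordinal (n_gt0 j).
have jk : (j + k.+1)%N = q by rewrite /=; lia.
have [s [sk sS [c sc]]] := IH j jk (delta_mx a 0).
have ij : (i < j)%N by [].
exists ((C i *m (tau *m delta_mx 0 a) *m R j) :: s); split.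
- by rewrite /= sk.
- move=> z; rewrite inE => /orP[/eqP->|/sS //].
  exact: (strict_unit_mem (tau *m delta_mx 0 a) ij).
exists c; rewrite prod_cons_mx -!mulmxA (mulmxA _ (C il)) sc.
rewrite (mulmxA (R j)) RC1 mul1mx mul_delta_mx.
by rewrite (_ : delta_mx 0 0 = 1%:M) ?mulmx1 //; apply/matrixP => x y; rewrite !ord1 !mxE.
Qed.

End Frame.

(** * Isomorphisms of block triangular algebras *)

(** Both directions are linear maps on all of M_N(K), and the conditions are symmetric in them, so
    each later lemma also serves for the inverse. *)
Definition inverse_isos (K : fieldType) N (A B : {vspace 'M[K]_N})
    (F G : {linear 'M[K]_N -> 'M[K]_N}) : Prop :=
  [/\ forall x, x \in A -> F x \in B, forall y, y \in B -> G y \in A,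
      forall x, x \in A -> G (F x) = x, forall y, y \in B -> F (G y) = y &
      [/\ F 1%:M = 1%:M, G 1%:M = 1%:M,
          forall x y, x \in A -> y \in A -> F (x *m y) = F x *m F y &
          forall x y, x \in B -> y \in B -> G (x *m y) = G x *m G y]].

Lemma inverse_isos_sym (K : fieldType) N (A B : {vspace 'M[K]_N}) F G :
  inverse_isos A B F G -> inverse_isos B A G F.
Proof. by case=> ? ? ? ? [? ? ? ?]. Qed.

Section StrictImage.
Variables (K : fieldType) (q N : nat) (n l : 'I_q -> nat).
Variables (R : forall i, 'M[K]_(n i, N)) (C : forall i, 'M[K]_(N, n i)).
Variables (R' : forall i, 'M[K]_(l i, N)) (C' : forall i, 'M[K]_(N, l i)).
Variables (D : forall i, {vspace 'M[K]_(n i)}) (A : {vspace 'M[K]_N}).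
Variables (D' : forall i, {vspace 'M[K]_(l i)}) (B : {vspace 'M[K]_N}).
Variables F G : {linear 'M[K]_N -> 'M[K]_N}.
Hypotheses (RC : frame R C) (AT : triangular_algebra R C D A).
Hypotheses (RC' : frame R' C') (BT : triangular_algebra R' C' D' B).
Hypothesis FG : inverse_isos A B F G.

Let E i := C i *m R i.
Let FB x : x \in A -> F x \in B. Proof. by case: FG => + _ _ _ _; apply. Qed.
Let FM x y : x \in A -> y \in A -> F (x *m y) = F x *m F y.
Proof. by case: FG => _ _ _ _ [_ _ + _]; apply. Qed.

(* The strictly upper triangular part is spanned by commutators [E i, x], and
   the diagonal blocks of a commutator vanish. *)
Lemma strict_image x : strict R C A x -> strict R' C' B (F x).
Proof.
case=> xA xu; split; first exact: FB.
have upB := triangular_upper BT.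
have comm0 y z i : y \in B -> z \in B -> R' i *m (y *m z - z *m y) *m C' i = 0.
  move=> yB zB; rewrite mulmxBr mulmxBl (frame_diag_mul RC' i (upB _ yB) (upB _ zB)).
  rewrite (frame_diag_mul RC' i (upB _ zB) (upB _ yB)).
  case: BT => _ /(_ i) [_ DC] _.
  by rewrite (DC _ _ (triangular_diag BT i yB) (triangular_diag BT i zB)) subrr.
have diag0 i : R' i *m F x *m C' i = 0.
  rewrite (frame_sum RC x) linear_sum mulmx_sumr mulmx_suml big1 // => p _.
  rewrite linear_sum mulmx_sumr mulmx_suml big1 // => k _.
  have [kp|pk] := leqP k p; first by rewrite xu ?addn1 // mulmx0 mul0mx linear0 mulmx0 mul0mx.
  have [yA _] := strict_unit_mem RC AT (R p *m x *m C k) pk.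
  set y := C p *m _ *m R k in yA *.
  have -> : y = E p *m y - y *m E p.
    case: RC => RC1 RC0 _; rewrite /y /E !mulmxA -(mulmxA (C p) (R p) (C p)) RC1 mulmx1.
    rewrite -[X in _ - X]mulmxA -(mulmxA _ (R k)) (mulmxA (R k)) RC0 ?mul0mx ?mulmx0 ?subr0 //.
    by apply/eqP => kp; subst k; rewrite ltnn in pk.
  have EA : E p \in A := idempotent_mem RC AT p.
  by rewrite linearB !FM //; apply: comm0; apply: FB.
move=> i j; rewrite addn1 ltnS leq_eqVlt => /orP[/eqP /val_inj ->|ji]; first exact: diag0.
by apply: upB; rewrite ?FB // addn0.
Qed.

Lemma prod_image s : (forall z, z \in s -> strict R C A z) ->
  F (\prod_(z <- s) z) = \prod_(z <- map F s) z.
Proof.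
elim: s => [|z s IH] sS; first by rewrite !big_nil; case: FG => _ _ _ _ [].
have sS' y : y \in s -> strict R C A y by move=> ys; apply: sS; rewrite inE ys orbT.
have [zA _] := sS z (mem_head _ _).
rewrite map_cons !prod_cons_mx FM ?IH //.
by have [] := prod_upper RC AT sS'.
Qed.

End StrictImage.

Section BlockIso.
Variables (K : fieldType) (q N : nat) (n l : 'I_q -> nat).
Variables (R : forall i, 'M[K]_(n i, N)) (C : forall i, 'M[K]_(N, n i)).
Variables (R' : forall i, 'M[K]_(l i, N)) (C' : forall i, 'M[K]_(N, l i)).
Variables (D : forall i, {vspace 'M[K]_(n i)}) (A : {vspace 'M[K]_N}).
Variables (D' : forall i, {vspace 'M[K]_(l i)}) (B : {vspace 'M[K]_N}).
Variables F G : {linear 'M[K]_N -> 'M[K]_N}.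
Hypotheses (RC : frame R C) (AT : triangular_algebra R C D A).
Hypotheses (RC' : frame R' C') (BT : triangular_algebra R' C' D' B).
Hypothesis FG : inverse_isos A B F G.
Hypothesis l_gt0 : forall i, (0 < l i)%N.

Let FB x : x \in A -> F x \in B. Proof. by case: FG => + _ _ _ _; apply. Qed.
Let GF x : x \in A -> G (F x) = x. Proof. by case: FG => _ _ + _ _; apply. Qed.
Let FK x : x \in B -> F (G x) = x. Proof. by case: FG => _ _ _ + _; apply. Qed.
Let GM x y : x \in B -> y \in B -> G (x *m y) = G x *m G y.
Proof. by case: FG => _ _ _ _ [_ _ _ +]; apply. Qed.
Let BM x y : x \in B -> y \in B -> x *m y \in B.
Proof. by case: BT => -[_ +] _ _; apply. Qed.

(* With T the ideal of strictly upper triangular elements, a_ii = 0 is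
   equivalent to T^(i-1) a T^(q-i) = 0 (1-based i), which F preserves. *)
Lemma diag_block_image a i : a \in A -> R i *m a *m C i = 0 -> R' i *m F a *m C' i = 0.
Proof.
move=> aA a0; have q0 : (0 < q)%N by have := ltn_ord i; lia.
have ql : (q.-1 < q)%N by lia.
apply/row_matrixP => u; rewrite row0; apply/rowP => v; rewrite [RHS]mxE.
(* [rho] and [tau] single out entry (u, v) of the block; the two paths realise them by products of i
   and of q - 1 - i strict elements of [B]. *)
pose rho : 'rV[K]_(l i) := delta_mx 0 u; pose tau : 'cV[K]_(l i) := delta_mx v 0.
have [s [sz sS [p ps]]] := left_path RC' BT l_gt0 (i0 := Ordinal q0) erefl erefl rho.
have ik : (i + (q.-1 - i).+1)%N = q by have := ltn_ord i; lia.
have ql' : (nat_of_ord (Ordinal ql)).+1 = q by rewrite /= prednK.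
have [t [tz tS [c tc]]] := right_path RC' BT l_gt0 ql' ik tau.
have [sB _] := prod_upper RC' BT sS; have [tB _] := prod_upper RC' BT tS.
(* [G] turns the strict factors into strict elements of [A] and F a back into [a], so
   [upper_sandwich] applies there. *)
have G0 : G (\prod_(z <- s) z *m F a *m \prod_(z <- t) z) = 0.
  rewrite !GM ?GF ?BM ?FB // (prod_image RC' BT (inverse_isos_sym FG) sS).
  rewrite (prod_image RC' BT (inverse_isos_sym FG) tS).
  have img w : (forall z, z \in w -> strict R' C' B z) ->
      forall z, z \in map G w -> strict R C A z.
    move=> wS z /mapP [y yw ->].
    exact: (strict_image RC' BT RC AT (inverse_isos_sym FG) (wS _ yw)).
  have [_ su] := prod_upper RC AT (img _ sS); have [_ tu] := prod_upper RC AT (img _ tS).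
  rewrite size_map sz in su; rewrite size_map tz in tu.
  exact: (upper_sandwich RC (triangular_upper AT aA) a0 su tu).
have Fa0 : \prod_(z <- s) z *m F a *m \prod_(z <- t) z = 0.
  by rewrite -[LHS]FK ?BM ?FB // G0 linear0.
have : rho *m (R' i *m F a *m C' i) *m tau = 0.
  rewrite !mulmxA -ps -(mulmxA _ (C' i)) -tc.
  have := congr1 (fun x => p *m R' (Ordinal q0) *m x *m (C' (Ordinal ql) *m c)) Fa0.
  by rewrite /= mulmx0 !mul0mx !mulmxA.
by rewrite /rho /tau -rowE -colE => /matrixP /(_ 0 0); rewrite !mxE.
Qed.

End BlockIso.

Section LocalIso.
Variables (K : fieldType) (q N : nat) (n l : 'I_q -> nat).
Variables (R : forall i, 'M[K]_(n i, N)) (C : forall i, 'M[K]_(N, n i)).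
Variables (R' : forall i, 'M[K]_(l i, N)) (C' : forall i, 'M[K]_(N, l i)).
Variables (D : forall i, {vspace 'M[K]_(n i)}) (A : {vspace 'M[K]_N}).
Variables (D' : forall i, {vspace 'M[K]_(l i)}) (B : {vspace 'M[K]_N}).
Variables F G : {linear 'M[K]_N -> 'M[K]_N}.
Hypotheses (RC : frame R C) (AT : triangular_algebra R C D A).
Hypotheses (RC' : frame R' C') (BT : triangular_algebra R' C' D' B).
Hypothesis FG : inverse_isos A B F G.
Hypotheses (n_gt0 : forall i, (0 < n i)%N) (l_gt0 : forall i, (0 < l i)%N).

Let E i := C i *m R i.
Let E' i := C' i *m R' i.
Let FB x : x \in A -> F x \in B. Proof. by case: FG => + _ _ _ _; apply. Qed.
Let GF x : x \in A -> G (F x) = x. Proof. by case: FG => _ _ + _ _; apply. Qed.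
Let FK x : x \in B -> F (G x) = x. Proof. by case: FG => _ _ _ + _; apply. Qed.
Let FM x y : x \in A -> y \in A -> F (x *m y) = F x *m F y.
Proof. by case: FG => _ _ _ _ [_ _ + _]; apply. Qed.
Let GM x y : x \in B -> y \in B -> G (x *m y) = G x *m G y.
Proof. by case: FG => _ _ _ _ [_ _ _ +]; apply. Qed.
Let F1 : F 1%:M = 1%:M. Proof. by case: FG => _ _ _ _ []. Qed.
Let AM x y : x \in A -> y \in A -> x *m y \in A.
Proof. by case: AT => -[_ +] _ _; apply. Qed.
Let BM x y : x \in B -> y \in B -> x *m y \in B.
Proof. by case: BT => -[_ +] _ _; apply. Qed.
Let EA i : E i \in A. Proof. exact: (idempotent_mem RC AT). Qed.
Let E'B i : E' i \in B. Proof. exact: (idempotent_mem RC' BT). Qed.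
Let RC1 i : R i *m C i = 1%:M. Proof. by case: RC => ->. Qed.
Let RC1' i : R' i *m C' i = 1%:M. Proof. by case: RC' => ->. Qed.
Let EE i : E i *m E i = E i. Proof. by rewrite /E mulmxA -(mulmxA (C i)) RC1 mulmx1. Qed.

(** The complementary idempotent 1 - E i has zero (i, i) block, and so has its image. *)
Lemma idempotent_block i : R' i *m F (E i) *m C' i = 1%:M.
Proof.
have A1 : 1%:M \in A by case: AT => -[].
have : R' i *m F (1%:M - E i) *m C' i = 0.
  apply: (diag_block_image RC AT RC' BT FG l_gt0); first by rewrite rpredB ?EA.
  by rewrite mulmxBr mulmxBl mulmx1 RC1 /E !mulmxA RC1 mul1mx RC1 subrr.
by rewrite linearB /= F1 mulmxBr mulmxBl mulmx1 RC1' => /eqP; rewrite subr_eq0 => /eqP.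
Qed.

(* F (E i) and E' i have the same diagonal blocks modulo strictly upper
   triangular terms, so F (E i) E' i F (E i) - F (E i) has diagonal block 0;
   its preimage lies in E i A E i and is therefore 0. *)
Lemma idempotent_sandwich i : F (E i) *m E' i *m F (E i) = F (E i).
Proof.
have A1 : 1%:M \in A by case: AT => -[].
set e := F (E i); have eB : e \in B by apply: FB.
pose y := e *m E' i *m e - e; have yB : y \in B by rewrite rpredB ?BM ?E'B.
apply/eqP; rewrite -subr_eq0 -/y; apply/eqP.
suff Gy : G y = 0 by rewrite -[y]FK // Gy linear0.
have y0 : R' i *m y *m C' i = 0.
  rewrite mulmxBr mulmxBl idempotent_block.
  have -> : R' i *m (e *m E' i *m e) *m C' i = (R' i *m e *m C' i) *m (R' i *m e *m C' i).
    by rewrite /E' !mulmxA.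
  by rewrite idempotent_block mulmx1 subrr.
have Gy0 : R i *m G y *m C i = 0.
  exact: (diag_block_image RC' BT RC AT (inverse_isos_sym FG) n_gt0 yB y0).
have -> : G y = E i *m G y *m E i.
  rewrite linearB /= !GM ?BM ?E'B // /e GF ?EA //.
  have absorb (e0 g : 'M[K]_N) : e0 *m e0 = e0 -> e0 *m (e0 *m g *m e0) *m e0 = e0 *m g *m e0.
    by move=> ee; rewrite !mulmxA ee -(mulmxA _ e0 e0) ee.
  by rewrite mulmxBr mulmxBl !EE absorb.
by rewrite /E -!mulmxA (mulmxA (R i)) (mulmxA _ (C i)) Gy0 mul0mx mulmx0.
Qed.

(** Where two factors meet at block [i], E' i may be inserted between their images although F (E i)
    and E' i differ; this makes [unit_map] multiplicative. *)
Lemma F_split i x y : x \in A -> y \in A -> x *m E i = x -> E i *m y = y ->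
  F (x *m y) = F x *m C' i *m (R' i *m F y).
Proof.
move=> xA yA xE Ey; rewrite -{1}xE -mulmxA {1}FM ?AM // FM //.
rewrite -[in LHS]idempotent_sandwich /E' -[in RHS]xE -[in RHS]Ey !FM //.
by rewrite !mulmxA.
Qed.

(** A single block is put in place, mapped by [F], and the (i, j) block of the image is kept; other
    blocks that [F] may produce are dropped. *)
Definition unit_map i j (x : 'M[K]_(n i, n j)) : 'M[K]_(l i, l j) :=
  (mulmxr (C' j) \o mulmx (R' i) \o F \o mulmxr (R j) \o mulmx (C i)) x.
HB.instance Definition _ i j := GRing.Linear.copy (@unit_map i j)
  (mulmxr (C' j) \o mulmx (R' i) \o F \o mulmxr (R j) \o mulmx (C i)).

Lemma unit_mapE i j x : @unit_map i j x = R' i *m F (C i *m x *m R j) *m C' j.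
Proof. by []. Qed.

Lemma unit_map_mul i j k (x : 'M_(n i, n j)) (y : 'M_(n j, n k)) :
  C i *m x *m R j \in A -> C j *m y *m R k \in A ->
  unit_map (x *m y) = unit_map x *m unit_map y.
Proof.
move=> xA yA; rewrite !unit_mapE.
have -> : C i *m (x *m y) *m R k = (C i *m x *m R j) *m (C j *m y *m R k).
  by rewrite !mulmxA -(mulmxA _ (R j)) RC1 mulmx1.
rewrite (@F_split j) //; first by rewrite !mulmxA.
  by rewrite /E !mulmxA -(mulmxA _ (R j)) RC1 mulmx1.
by rewrite /E !mulmxA -(mulmxA _ (R j)) RC1 mulmx1.
Qed.

Lemma unit_map_inj i j (x : 'M_(n i, n j)) :
  C i *m x *m R j \in A -> unit_map x = 0 -> x = 0.
Proof.
move=> xA; rewrite unit_mapE => x0; set X := C i *m x *m R j in xA x0.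
have EX : E i *m X = X by rewrite /E /X !mulmxA -(mulmxA _ (R i)) RC1 mulmx1.
have XE : X *m E j = X by rewrite /E /X !mulmxA -(mulmxA _ (R j)) RC1 mulmx1.
(* As X = E i X E j, splitting on both sides expresses F X through its (i, j) block alone, so
   dropping the other blocks loses nothing. *)
have FX : F X = 0.
  rewrite -EX (@F_split i) // -[X in R' i *m F X]XE (@F_split j) // !(mulmxA (R' i)).
  by rewrite x0 mul0mx mulmx0.
have X0 : X = 0 by rewrite -[X]GF // FX linear0.
by move: (congr1 (fun Y => R i *m Y *m C j) X0); rewrite /X !mulmxA RC1 mul1mx -mulmxA RC1 mulmx1 mulmx0 mul0mx.
Qed.

Lemma unit_map_embedding i : embedding (D i) (D' i) (@unit_map i i).
Proof.
split=> [a aD|a aD||a b aD bD].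
- by rewrite unit_mapE; apply: (triangular_diag BT); apply: FB; apply: (diag_unit_mem RC AT).
- by apply: unit_map_inj; apply: (diag_unit_mem RC AT).
- by rewrite unit_mapE mulmx1 idempotent_block.
by apply: unit_map_mul; apply: (diag_unit_mem RC AT).
Qed.

End LocalIso.

(** * Conclusion *)

(** The increment from a to a + 1 is [uphalf a], positive for a > 0; the values at 0 and 1
    coincide. *)
Lemma quarter_square_inj m p : (0 < m)%N -> (0 < p)%N -> quarter_square m = quarter_square p -> m = p.
Proof.
have lt1 a : (0 < a)%N -> (quarter_square a < quarter_square a.+1)%N.
  move=> a0; rewrite /quarter_square; have -> : a.+1./2 = uphalf a by lia.
  have -> : uphalf a.+1 = a./2.+1 by lia.
  by rewrite mulnS [(uphalf a * _)%N]mulnC -[ltnLHS]add0n ltn_add2r; lia.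
have lt a d : (0 < a)%N -> (quarter_square a < quarter_square (a + d.+1))%N.
  move=> a0; elim: d => [|d IH]; first by rewrite addn1 lt1.
  by apply: ltn_trans IH _; rewrite [(a + d.+2)%N]addnS lt1 // addnS.
move=> m0 p0 E; case: (ltngtP m p) => // l.
  by have := lt m (p - m).-1 m0; rewrite prednK ?subn_gt0 // subnKC ?E ?ltnn // ltnW.
by have := lt p (m - p).-1 p0; rewrite prednK ?subn_gt0 // subnKC ?E ?ltnn // ltnW.
Qed.

Section Final.
Variable K : fieldType.

Lemma alg_isomorphic_inverse_isos N (A B : {vspace 'M[K]_N}) :
  subalgebra A -> subalgebra B -> alg_isomorphic A B ->
  exists F G, inverse_isos A B F G.
Proof.
move=> [A1 AM] [B1 BM] [f [[g fg gf] f1 fM]].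
have kf : lker (linfun f) == 0%VS.
  by apply/lker0P => x y; rewrite !lfunE => /(can_inj fg).
(* [vsproj A] is a linear retraction onto [A], which extends the isomorphism to all matrices. *)
pose F : {linear 'M[K]_N -> 'M[K]_N} := vsval \o f \o vsproj A.
pose G : {linear 'M[K]_N -> 'M[K]_N} := vsval \o (linfun f)^-1%VF \o vsproj B.
have FB x : F x \in B by apply: subvsP.
have GA x : G x \in A by apply: subvsP.
have GF x : x \in A -> G (F x) = x.
  move=> xA; rewrite /F /G /= vsvalK -[f _]lfunE lker0_lfunK // vsprojK //.
have FG x : x \in B -> F (G x) = x.
  move=> xB; rewrite /F /G /= vsvalK -[vsproj B x]gf -[f (g _)]lfunE lker0_lfunK //.
  by rewrite gf vsprojK.
have F1 : F 1%:M = 1%:M by rewrite /F /=; apply: f1; rewrite vsprojK.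
have FM x y : x \in A -> y \in A -> F (x *m y) = F x *m F y.
  by move=> xA yA; apply: fM; rewrite !vsprojK //; apply: AM.
exists F, G; split=> //; split=> // [|x y xB yB]; first by rewrite -F1 GF.
by rewrite -{1}(FG x) // -{1}(FG y) // -FM ?GF ?AM.
Qed.

Lemma of_type_triangular q N (n : q.-tuple nat) (hn : (\sum_(i < q) tnth n i)%N = N)
    (A : {vspace 'M[K]_N}) (D : forall i, {vspace 'M[K]_(tnth n i)}) R C :
  (forall (x : 'M[K]_N) i j, block hn x i j = R i *m x *m C j) ->
  Dq_of_type_max_dim hn A D -> triangular_algebra R C D A.
Proof.
move=> bE [[Aa Da AE] Dm]; split=> // [i|x]; first by case: (Dm i).
rewrite AE; split=> -[xD xu]; split.
- by move=> i; rewrite -bE; apply: xD.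
- by move=> i j; rewrite addn0 -bE; apply: xu.
- by move=> i; rewrite bE; apply: xD.
by move=> i j ji; rewrite bE; apply: xu; rewrite addn0.
Qed.

(** This is where q >= 2 enters: block 0 acts from the left on the (0, 1) block, and every other
    diagonal block [i] acts from the right on the (0, i) block. *)
Lemma inverse_isos_bilinked q N (n : 'I_q -> nat)
    (R R' : forall i, 'M[K]_(n i, N)) (C C' : forall i, 'M[K]_(N, n i))
    (D D' : forall i, {vspace 'M[K]_(n i)}) (A B : {vspace 'M[K]_N}) F G i :
  frame R C -> triangular_algebra R C D A ->
  frame R' C' -> triangular_algebra R' C' D' B ->
  inverse_isos A B F G -> (forall i, (0 < n i)%N) -> (1 < q)%N ->
  exists2 s, (0 < s)%N & bilinked s (D i) (D' i).
Proof.
move=> RC AT RC' BT FG n0 q2; have GF := inverse_isos_sym FG.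
pose i0 := Ordinal (ltnW q2).
have [ii0|ni0] := eqVneq i i0.
  pose j := Ordinal q2; have ij : (i < j)%N by rewrite ii0.
  exists (n j) => //; left; split.
    exists (@unit_map K q N n n R C R' C' F i i), (@unit_map K q N n n R C R' C' F i j); split.
    - exact: (unit_map_embedding RC AT RC' BT FG n0 n0).
    - by move=> x; apply: (unit_map_inj RC AT RC' BT FG n0 n0); case: (strict_unit_mem RC AT x ij).
    move=> a x aD; apply: (unit_map_mul RC AT RC' BT FG n0 n0).
      exact: (diag_unit_mem RC AT).
    by case: (strict_unit_mem RC AT x ij).
  exists (@unit_map K q N n n R' C' R C G i i), (@unit_map K q N n n R' C' R C G i j); split.
  - exact: (unit_map_embedding RC' BT RC AT GF n0 n0).
  - by move=> x; apply: (unit_map_inj RC' BT RC AT GF n0 n0); case: (strict_unit_mem RC' BT x ij).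
  move=> a x aD; apply: (unit_map_mul RC' BT RC AT GF n0 n0).
    exact: (diag_unit_mem RC' BT).
  by case: (strict_unit_mem RC' BT x ij).
have ji : (i0 < i)%N by rewrite lt0n.
exists (n i0) => //; right; split.
  exists (@unit_map K q N n n R C R' C' F i i), (@unit_map K q N n n R C R' C' F i0 i); split.
  - exact: (unit_map_embedding RC AT RC' BT FG n0 n0).
  - by move=> x; apply: (unit_map_inj RC AT RC' BT FG n0 n0); case: (strict_unit_mem RC AT x ji).
  move=> a x aD; apply: (unit_map_mul RC AT RC' BT FG n0 n0); last exact: (diag_unit_mem RC AT).
  by case: (strict_unit_mem RC AT x ji).
exists (@unit_map K q N n n R' C' R C G i i), (@unit_map K q N n n R' C' R C G i0 i); split.
- exact: (unit_map_embedding RC' BT RC AT GF n0 n0).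
- by move=> x; apply: (unit_map_inj RC' BT RC AT GF n0 n0); case: (strict_unit_mem RC' BT x ji).
move=> a x aD; apply: (unit_map_mul RC' BT RC AT GF n0 n0); last exact: (diag_unit_mem RC' BT).
by case: (strict_unit_mem RC' BT x ji).
Qed.

(** The isomorphism is conjugation by the block diagonal matrix [Y] assembled from the conjugating
    matrices of the blocks; the zero blocks below the diagonal stay zero. *)
Lemma conjugate_blocks_isomorphic q N (n : 'I_q -> nat)
    (R : forall i, 'M[K]_(n i, N)) (C : forall i, 'M[K]_(N, n i))
    (D D' : forall i, {vspace 'M[K]_(n i)}) (A B : {vspace 'M[K]_N}) :
  frame R C -> triangular_algebra R C D A -> triangular_algebra R C D' B ->
  (forall i, simconj (D i) (D' i)) -> alg_isomorphic A B.
Proof.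
move=> RC AT BT DD; have [RC1 RC0 E] := RC.
have [X uX eD] : exists2 X : forall i, 'M[K]_(n i), forall i, X i \in unitmx &
    forall i Y, (Y \in D' i) = (X i *m Y *m invmx (X i) \in D i).
  have /fin_all_exists [X XD] : forall i, exists X : 'M[K]_(n i), X \in unitmx /\
      forall Y, (Y \in D' i) = (X *m Y *m invmx X \in D i).
    by move=> i; have [X uX eD] := DD i; exists X.
  by exists X => i; case: (XD i).
pose Y := \sum_i C i *m X i *m R i; pose Y' := \sum_i C i *m invmx (X i) *m R i.
have pick Z k : R k *m (\sum_i C i *m Z i *m R i) = Z k *m R k.
  rewrite mulmx_sumr (bigD1 k) //= big1 => [|i ik].
    by rewrite addr0 !mulmxA RC1 mul1mx.
  by rewrite !mulmxA RC0 ?mul0mx // eq_sym.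
have pickr Z k : (\sum_i C i *m Z i *m R i) *m C k = C k *m Z k.
  rewrite mulmx_suml (bigD1 k) //= big1 => [|i ik].
    by rewrite addr0 -!mulmxA RC1 mulmx1.
  by rewrite -!mulmxA RC0 ?mulmx0.
have blocks Z Z' x i j : R i *m ((\sum_i C i *m Z i *m R i) *m x *m
    (\sum_i C i *m Z' i *m R i)) *m C j = Z i *m (R i *m x *m C j) *m Z' j.
  by rewrite -!mulmxA pickr !mulmxA pick.
have YY' : Y' *m Y = 1%:M.
  rewrite /Y' mulmx_suml -E; apply: eq_bigr => i _.
  by rewrite -!mulmxA pick (mulmxA (invmx _)) mulVmx // mul1mx.
have Y'Y : Y *m Y' = 1%:M by apply: mulmx1C.
have toB x : x \in A -> Y' *m x *m Y \in B.
  case: AT => _ _ AE; case: BT => _ _ BE; rewrite AE BE => -[xD xu]; split=> [i|i j ij].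
    by rewrite blocks eD !mulmxA mulmxV // mul1mx -!mulmxA mulmxV // mulmx1 !mulmxA.
  by rewrite blocks xu // mulmx0 mul0mx.
have toA x : x \in B -> Y *m x *m Y' \in A.
  case: AT => _ _ AE; case: BT => _ _ BE; rewrite AE BE => -[xD xu]; split=> [i|i j ij].
    by rewrite blocks -eD; apply: xD.
  by rewrite blocks xu // mulmx0 mul0mx.
pose f : {linear subvs_of A -> subvs_of B} := vsproj B \o mulmxr Y \o mulmx Y' \o vsval.
have fE u : vsval (f u) = Y' *m vsval u *m Y by rewrite /f /= vsprojK // toB ?subvsP.
have gE (w : subvs_of B) : vsval (vsproj A (Y *m vsval w *m Y')) = Y *m vsval w *m Y'.
  by rewrite vsprojK //; apply: toA; apply: subvsP.
exists f; split.
- exists (fun u : subvs_of B => vsproj A (Y *m vsval u *m Y')) => u; apply: val_inj.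
    rewrite [LHS]gE fE !mulmxA Y'Y mul1mx.
    by rewrite -mulmxA Y'Y mulmx1.
  rewrite [LHS]fE gE !mulmxA YY' mul1mx.
  by rewrite -mulmxA YY' mulmx1.
- by move=> u u1; rewrite fE u1 mulmx1.
move=> x y z zE; rewrite !fE zE !mulmxA -(mulmxA _ Y Y') Y'Y mulmx1 //.
Qed.

End Final.

Theorem theorem6p6 (K : closedFieldType) (q N : nat) (n l : q.-tuple nat)
    (hq : (2 <= q)%N)
    (n_gt0 : forall j : 'I_q, (0 < tnth n j)%N)
    (l_gt0 : forall j : 'I_q, (0 < tnth l j)%N)
    (hn : (\sum_(j < q) tnth n j)%N = N)
    (hl : (\sum_(j < q) tnth l j)%N = N)
    (A B : {vspace 'M[K]_N})
    (dA : forall j : 'I_q, {vspace 'M[K]_(tnth n j)})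
    (dB : forall j : 'I_q, {vspace 'M[K]_(tnth l j)})
    (hA : Dq_of_type_max_dim hn A dA)
    (hB : Dq_of_type_max_dim hl B dB) :
  (alg_isomorphic A B <->
     n = l /\ forall j : 'I_q, conjugated (dA j) (dB j)) /\
  (alg_isomorphic A B ->
     forall j : 'I_q, exists! k : nat,
       [/\ k \in superscripts (tnth n j),
           conjugated (dA j) (C K k (tnth n j))
         & conjugated (dB j) (C K k (tnth n j))]).
Proof.
have [R [Cl [RC bA]]] := block_frame K hn; have AT := of_type_triangular bA hA.
have [[Aa _ _] Am] := hA; have [[Ba _ _] Bm] := hB.
have iso_conj : alg_isomorphic A B -> n = l /\ forall j, conjugated (dA j) (dB j).
  move=> /(alg_isomorphic_inverse_isos Aa Ba) [F [G FG]].
  have [R' [C' [RC' bB]]] := block_frame K hl; have BT := of_type_triangular bB hB.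
  have nl : n = l.
    (* The embeddings in both directions equate the dimensions of the diagonal blocks, and these
       determine the block sizes. *)
    apply: eq_from_tnth => j; apply: quarter_square_inj => //; apply: succn_inj.
    rewrite -(dim_max_commutative (n_gt0 j) (Am j)) -(dim_max_commutative (l_gt0 j) (Bm j)).
    apply/eqP; rewrite eqn_leq; apply/andP; split.
      by have [] := embedding_dim (unit_map_embedding RC AT RC' BT FG n_gt0 l_gt0 j).
    by have [] := embedding_dim (unit_map_embedding RC' BT RC AT (inverse_isos_sym FG) l_gt0 n_gt0 j).
  split=> // j; subst l.
  have [s s0 sAB] := inverse_isos_bilinked j RC AT RC' BT FG n_gt0 hq.
  have [k kj kA] := classification (n_gt0 j) (Am j).
  have [k' kj' kB] := classification (n_gt0 j) (Bm j).
  have kk' : k = k'.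
    apply: (C_bilinked_inj s0 kj kj' _ _ (bilinked_simconj kA kB sAB)).
      exact: (simconj_commutative kA (Am j).1).1.
    exact: (simconj_commutative kB (Bm j).1).1.
  by apply/conjugatedP/(simconj_trans kA)/simconj_sym; rewrite kk'.
split; first split=> // [[nl AB]].
  (* Identifying the two proofs of the size equation lets both algebras be read in the same
     frame. *)
  subst l; have hnl : hl = hn by apply: eq_irrelevance.
  subst hl; have BT := of_type_triangular bA hB.
  by apply: (conjugate_blocks_isomorphic RC AT BT) => j; apply/conjugatedP.
move=> /iso_conj [nl AB] j; subst l.
have [k kj kA] := classification (n_gt0 j) (Am j).
have AB' := (conjugatedP _ _).1 (AB j).
exists k; split.
  split=> //; apply/conjugatedP => //.
  exact: simconj_trans (simconj_sym AB') kA.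
move=> k' [kj' /conjugatedP kA' _].
have sim := simconj_trans (simconj_sym kA) kA'.
(* Conjugated algebras are linked on matrices of any width, so width 1 suffices to compare the
   superscripts. *)
apply: (C_bilinked_inj (isT : (0 < 1)%N) kj kj' _ _ (simconj_bilinked 1 sim)).
  exact: (simconj_commutative kA (Am j).1).1.
exact: (simconj_commutative kA' (Am j).1).1.
Qed.
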